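(* Let $M$ be a smooth manifold, $A\subset TM\setminus 0$ a conic open subset with $\pi(A)=M$, and $L:A\to\mathbb{R}$ a pseudo-Finsler metric with fundamental tensor $g$. Then the Chern connection of $L$ (viewed as an anisotropic connection) is the only anisotropic linear connection $\nabla$ on $A$ which is torsion-free and satisfies $\nabla g=0$.
   Context: $\pi:TM\to M$ is the projection. $A$ conic means $\lambda v\in A$ for all $v\in A$, $\lambda>0$. A pseudo-Finsler metric is a smooth function $L:A\to\mathbb{R}$, positively homogeneous of degree two ($L(\lambda v)=\lambda^2L(v)$ for $\lambda>0$), whose fundamental tensor $g_v(u,w)=\frac12\frac{\partial^2}{\partial t\partial s}L(v+tu+sw)|_{t=s=0}$ ($v\in A$, $u,w\in T_{\pi(v)}M$) is non-degenerate for every $v\in A$. The Cartan tensor is $C_v(w_1,w_2,w_3)=\frac14\frac{\partial^3}{\partial s_3\partial s_2\partial s_1}L(v+\sum_is_iw_i)|_{s_1=s_2=s_3=0}$. An anisotropic (linear) connection is a map $(v,X,Y)\mapsto\nabla^v_XY\in T_{\pi(v)}M$, $v\in A$, $X,Y\in\mathfrak{X}(M)$, such that $v\mapsto\nabla^v_XY$ is smooth, additive in $Y$, $\mathcal{F}(M)$-linear in $X$, and $\nabla^v_X(fY)=X(f)Y|_{\pi(v)}+f(\pi(v))\nabla^v_XY$ for $f\in\mathcal{F}(M)$. Its Christoffel symbols are $\nabla^v_{\partial_j}\partial_k=\Gamma^i_{\ jk}(v)\partial_i$. It is torsion-free if $\nabla^v_XY-\nabla^v_YX=[X,Y]_{\pi(v)}$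 for all $v\in A$, $X,Y\in\mathfrak{X}(M)$. The covariant derivative of $g$ with respect to an anisotropic connection is $$(\nabla_Xg)_v(Y,Z)=X(g_V(Y,Z))(\pi(v))-g_v(\nabla^v_XY,Z)-g_v(Y,\nabla^v_XZ)-2C_v(Y,Z,\nabla^v_XV),$$ where $V$ is any vector field near $\pi(v)$ with values in $A$ and $V(\pi(v))=v$ (the result is independent of $V$), and $g_V$ is the tensor field $p\mapsto g_{V(p)}$; $\nabla g=0$ means that this vanishes for all $v\in A$ and $X,Y,Z\in\mathfrak{X}(M)$. The Chern connection of $L$ is the anisotropic connection with Christoffel symbols, in natural coordinates $(x,y)$ on $TM$, $$\Gamma^i_{\ jk}=\tfrac12g^{is}\Big(\frac{\delta g_{sj}}{\delta x^k}-\frac{\delta g_{jk}}{\delta x^s}+\frac{\delta g_{ks}}{\delta x^j}\Big),\qquad\frac{\delta}{\delta x^i}=\frac{\partial}{\partial x^i}-N^k_{\ i}\frac{\partial}{\partial y^k},$$ where $g_{ij}(v)=g_v(\partial_i,\partial_j)$, $(g^{ij})$ is the inverse matrix, $N^k_{\ i}=\frac{\partial G^k}{\partial y^i}$ and $G^i=\frac14g^{is}\big(2\frac{\partial g_{sj}}{\partial x^k}-\frac{\partial g_{jk}}{\partial x^s}\big)y^jy^k$. *)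

(* Defs.v *)
From mathcomp Require Import all_boot all_order all_algebra.
From mathcomp Require Import all_classical all_reals topology normedtype derive.

Set Implicit Arguments.
Unset Strict Implicit.
Unset Printing Implicit Defensive.

Import Order.TTheory GRing.Theory Num.Theory.
Import numFieldNormedType.Exports.

Local Open Scope classical_set_scope.
Local Open Scope ring_scope.

(* [class_C k U f]: on the open set U, all iterated directional derivatives of
   f of order <= k exist and are continuous. On finite-dimensional spaces, the
   only ones used below, this is the usual C^k. *)
Fixpoint class_C (R : realType) (V W : normedModType R) (k : nat)
    (U : set V) (f : V -> W) : Prop :=
  (forall x, U x -> {for x, continuous f}) /\
  if k is k'.+1 then
    forall v, (forall x, U x -> derivable f x v) /\ class_C k' U ('D_v f)
  else True.

Definition smooth (R : realType) (V W : normedModType R)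
    (U : set V) (f : V -> W) : Prop :=
  forall k, class_C k U f.

(* Smooth n-dimensional manifold: a Hausdorff second countable space with a
   smooth atlas. [phi c : dom c -> cod c] is the chart c and [psi c] its
   inverse; both are total functions, meaningful on [dom c], [cod c] only. *)
Record manifold (R : realType) (n : nat) := Manifold {
  space :> topologicalType ;
  hausdorff : hausdorff_space space ;
  countable_base : @second_countable space ;
  chart : Type ;
  dom : chart -> set space ;
  cod : chart -> set 'rV[R]_n ;
  phi : chart -> space -> 'rV[R]_n ;
  psi : chart -> 'rV[R]_n -> space ;
  open_dom : forall c, open (dom c) ;
  open_cod : forall c, open (cod c) ;
  phi_cod : forall c p, dom c p -> cod c (phi c p) ;
  psi_dom : forall c x, cod c x -> dom c (psi c x) ;
  phiK : forall c p, dom c p -> psi c (phi c p) = p ;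
  psiK : forall c x, cod c x -> phi c (psi c x) = x ;
  phi_cont : forall c p, dom c p -> {for p, continuous (phi c)} ;
  psi_cont : forall c x, cod c x -> {for x, continuous (psi c)} ;
  transition_smooth : forall c d,
    smooth (cod c `&` psi c @^-1` dom d) (phi d \o psi c) ;
  atlas_cover : forall p, exists c, dom c p }.

Section TangentBundle.
Variables (R : realType) (n : nat) (M : manifold R n).

Definition chart_at (p : M) : chart M := projT1 (cid (atlas_cover p)).

Lemma chart_atP (p : M) : dom (chart_at p) p.
Proof. exact: projT2 (cid (atlas_cover p)). Qed.

(* A tangent vector at p is encoded by its components in the chart
   [chart_at p]. Its components in any other chart are obtained with the
   differential of the transition map: see [coord] and [of_coord]. *)
Definition tangent (p : M) : Type := 'rV[R]_n.

(* For p in [dom c], components in the chart c of a vector at p... *)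
Definition coord (c : chart M) (p : M) (v : tangent p) : 'rV[R]_n :=
  'D_v (phi c \o psi (chart_at p)) (phi (chart_at p) p).
Arguments coord c p v : clear implicits.

(* ... and the vector at p with given components in the chart c. *)
Definition of_coord (c : chart M) (p : M) (y : 'rV[R]_n) : tangent p :=
  'D_y (phi (chart_at p) \o psi c) (phi c p).

Definition TM : Type := {p : M & tangent p}.

Definition tvec (p : M) (v : tangent p) : TM := existT tangent p v.
Arguments tvec p v : clear implicits.

Definition foot (v : TM) : M := projT1 v.

Definition vect (v : TM) : tangent (foot v) := projT2 v.

(* The inverse of the natural coordinates (x, y) of TM above the chart c. *)
Definition nat_param (c : chart M) (z : 'rV[R]_n * 'rV[R]_n) : TM :=
  tvec (psi c z.1) (of_coord c (psi c z.1) z.2).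

Definition nat_coord (c : chart M) (v : TM) : 'rV[R]_n * 'rV[R]_n :=
  (phi c (foot v), coord c (foot v) (vect v)).

Definition nat_image (c : chart M) (A : set TM) : set ('rV[R]_n * 'rV[R]_n) :=
  [set z | cod c z.1 /\ A (nat_param c z)].

(* Open for the manifold topology of TM. *)
Definition open_TM (A : set TM) : Prop := forall c, open (nat_image c A).

Definition conic (A : set TM) : Prop :=
  forall (v : TM) (l : R), A v -> 0 < l -> A (tvec (foot v) (l *: vect v)).

Definition smooth_TM (A : set TM) (f : TM -> R) : Prop :=
  forall c, smooth (nat_image c A) (f \o nat_param c).

Definition smooth_fun (f : M -> R) : Prop :=
  forall c, smooth (cod c) (f \o psi c).

(* Arbitrary sections of TM; the elements of X(M) are the smooth ones. *)
Definition vfield : Type := forall p : M, tangent p.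

Definition components (c : chart M) (X : vfield) (x : 'rV[R]_n) : 'rV[R]_n :=
  coord c (psi c x) (X (psi c x)).

Definition smooth_vfield (X : vfield) : Prop :=
  forall c, smooth (cod c) (components c X).

(* v(f), for v in T_pM and f smooth near p. *)
Definition dirder (p : M) (v : tangent p) (f : M -> R) : R :=
  'D_v (f \o psi (chart_at p)) (phi (chart_at p) p).
Arguments dirder p v f : clear implicits.

(* [X, Y]^i = X^j d_j Y^i - Y^j d_j X^i, in the chart [chart_at p]. *)
Definition bracket (X Y : vfield) : vfield := fun p =>
  'D_(X p) (components (chart_at p) Y) (phi (chart_at p) p)
  - 'D_(Y p) (components (chart_at p) X) (phi (chart_at p) p).

(* The coordinate field d/dx^k of the chart c. *)
Definition partial (c : chart M) (k : 'I_n) : vfield := fun p =>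
  of_coord c p (delta_mx 0 k).

End TangentBundle.

Arguments coord {R n M} c p v.
Arguments tvec {R n M} p v.
Arguments dirder {R n M} p v f.

Section PseudoFinsler.
Variables (R : realType) (n : nat) (M : manifold R n).
Implicit Types (A : set (TM M)) (L : TM M -> R) (v : TM M).

(* Only the restriction of L to A is meaningful. *)

Definition fundamental_tensor L v (u w : tangent (foot v)) : R :=
  2^-1 * derive1 (fun t : R =>
    derive1 (fun s : R => L (tvec (foot v) (vect v + t *: u + s *: w))) 0) 0.
Arguments fundamental_tensor L v u w : clear implicits.

Definition cartan_tensor L v (w1 w2 w3 : tangent (foot v)) : R :=
  4^-1 * derive1 (fun s3 : R => derive1 (fun s2 : R => derive1 (fun s1 : R =>
    L (tvec (foot v) (vect v + (s1 *: w1 + s2 *: w2 + s3 *: w3)))) 0) 0) 0.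
Arguments cartan_tensor L v w1 w2 w3 : clear implicits.

Record pseudo_Finsler A L : Prop := PseudoFinsler {
  pF_smooth : smooth_TM A L ;
  pF_homogeneous : forall v (l : R), A v -> 0 < l ->
    L (tvec (foot v) (l *: vect v)) = l ^+ 2 * L v ;
  pF_nondegenerate : forall v, A v -> forall u : tangent (foot v),
    (forall w : tangent (foot v), fundamental_tensor L v u w = 0) -> u = 0 }.

(* [nabla v X Y] stands for nabla^v_X Y; only its values for v in A and
   X, Y smooth are meaningful. *)
Definition connection : Type :=
  forall v : TM M, vfield M -> vfield M -> tangent (foot v).

Record anisotropic_connection A (nabla : connection) : Prop :=
  AnisotropicConnection {
  ac_smooth : forall X Y, smooth_vfield X -> smooth_vfield Y ->
    forall c, smooth (nat_image c A)
                (fun z => coord c (psi c z.1) (nabla (nat_param c z) X Y)) ;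
  ac_addr : forall X Y Z v, A v ->
    smooth_vfield X -> smooth_vfield Y -> smooth_vfield Z ->
    nabla v X (fun p => Y p + Z p) = nabla v X Y + nabla v X Z ;
  ac_addl : forall X Y Z v, A v ->
    smooth_vfield X -> smooth_vfield Y -> smooth_vfield Z ->
    nabla v (fun p => X p + Y p) Z = nabla v X Z + nabla v Y Z ;
  ac_scalel : forall f X Y v, A v ->
    smooth_fun f -> smooth_vfield X -> smooth_vfield Y ->
    nabla v (fun p => f p *: X p) Y = f (foot v) *: nabla v X Y ;
  ac_leibniz : forall f X Y v, A v ->
    smooth_fun f -> smooth_vfield X -> smooth_vfield Y ->
    nabla v X (fun p => f p *: Y p) =
      dirder (foot v) (X (foot v)) f *: Y (foot v) + f (foot v) *: nabla v X Y }.

Definition eq_connection A (nabla nabla' : connection) : Prop :=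
  forall v X Y, A v -> smooth_vfield X -> smooth_vfield Y ->
    nabla v X Y = nabla' v X Y.

(* The fields d/dx^j are only defined on [dom c]: nabla is applied to fields of
   X(M) which coincide with them near the base point, and such fields exist. *)
Definition has_christoffel A (nabla : connection) (c : chart M)
    (Gamma : 'I_n -> 'I_n -> 'I_n -> TM M -> R) : Prop :=
  forall v (j k : 'I_n) X Y, A v -> dom c (foot v) ->
    smooth_vfield X -> smooth_vfield Y ->
    (\forall p \near foot v, X p = partial c j p) ->
    (\forall p \near foot v, Y p = partial c k p) ->
    nabla v X Y = \sum_i Gamma i j k v *: partial c i (foot v).

Definition torsion_free A (nabla : connection) : Prop :=
  forall v X Y, A v -> smooth_vfield X -> smooth_vfield Y ->
    nabla v X Y - nabla v Y X = bracket X Y (foot v).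

(* (nabla_X g)_v (Y, Z), computed with the extension V of v. *)
Definition covariant_derivative_g L (nabla : connection) v
    (X Y Z V : vfield M) : R :=
  dirder (foot v) (X (foot v))
    (fun p => fundamental_tensor L (tvec p (V p)) (Y p) (Z p))
  - fundamental_tensor L v (nabla v X Y) (Z (foot v))
  - fundamental_tensor L v (Y (foot v)) (nabla v X Z)
  - 2 * cartan_tensor L v (Y (foot v)) (Z (foot v)) (nabla v X V).

(* A field near the base point of v may be replaced by an element of X(M)
   with the same germ, so it is enough to let V range over X(M). *)
Definition metric_compatible A L (nabla : connection) : Prop :=
  forall v X Y Z V, A v ->
    smooth_vfield X -> smooth_vfield Y -> smooth_vfield Z ->
    smooth_vfield V -> V (foot v) = vect v ->
    (\forall p \near foot v, A (tvec p (V p))) ->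
    covariant_derivative_g L nabla v X Y Z V = 0.

End PseudoFinsler.

Arguments fundamental_tensor {R n M} L v u w.
Arguments cartan_tensor {R n M} L v w1 w2 w3.

Section Chern.
Variables (R : realType) (n : nat) (M : manifold R n).
Variables (A : set (TM M)) (L : TM M -> R) (c : chart M).
Local Notation RnRn := ('rV[R]_n * 'rV[R]_n)%type.
Implicit Types (f : RnRn -> R) (z : RnRn) (i j k s : 'I_n).

(* Partial derivatives in the natural coordinates z = (x, y) above c. *)
Definition ddx k f z : R := 'D_((delta_mx 0 k, 0) : RnRn) f z.
Definition ddy k f z : R := 'D_((0, delta_mx 0 k) : RnRn) f z.

Definition g_coef i j z : R :=
  fundamental_tensor L (nat_param c z)
    (partial c i (psi c z.1)) (partial c j (psi c z.1)).

Definition g_inv i j z : R := invmx (\matrix_(a, b) g_coef a b z) i j.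

Definition spray_coef i z : R :=
  4^-1 * \sum_s \sum_j \sum_k g_inv i s z *
    (2 * ddx k (g_coef s j) z - ddx s (g_coef j k) z) * z.2 0 j * z.2 0 k.

(* N^k_i *)
Definition nonlinear_coef k i z : R := ddy i (spray_coef k) z.

Definition deltadx i f z : R :=
  ddx i f z - \sum_k nonlinear_coef k i z * ddy k f z.

(* Gamma^i_jk *)
Definition chern_coef i j k z : R :=
  2^-1 * \sum_s g_inv i s z *
    (deltadx k (g_coef s j) z - deltadx s (g_coef j k) z
     + deltadx j (g_coef k s) z).

End Chern.

Definition chern_connection (R : realType) (n : nat) (M : manifold R n)
    (A : set (TM M)) (L : TM M -> R) (nabla : connection M) : Prop :=
  anisotropic_connection A nabla /\
  forall c : chart M, has_christoffel A nabla c
    (fun i j k v => chern_coef L c i j k (nat_coord c v)).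

(* Main.v *)
Require Import Defs.
From HB Require Import structures.
From mathcomp Require Import all_boot all_order all_algebra.
From mathcomp Require Import all_classical all_reals topology normedtype derive.
From mathcomp Require Import realfun sequences exp ring lra.

Set Implicit Arguments.
Unset Strict Implicit.
Unset Printing Implicit Defensive.

Import Order.TTheory GRing.Theory Num.Theory.
Import numFieldNormedType.Exports.

Local Open Scope classical_set_scope.
Local Open Scope ring_scope.

(* In the natural coordinates of a chart the two conditions read, pointwise at z = (x, y),
   d_x g(u, w) = g(Gamma(x, u), w) + g(u, Gamma(x, w)) + 2 C(u, w, Gamma(x, y)) with Gamma
   symmetric.  The Chern symbols solve this system: differentiating the definition of the
   spray G along the fibre, and using C(., ., y) = 0, gives Gamma(u, y) = N(u).  The
   solution is unique at each v: the difference T of two solutions satisfies the homogeneous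
   system, whence T(V, V) = 0, then T(X, V) = 0, then T = 0.  Since torsion and nabla g do
   not depend on charts, this uniqueness also shows that the connections defined by the
   Chern symbols in two charts agree, so that no transformation law has to be computed.
   Finally bump functions show that an anisotropic connection is determined by its
   Christoffel symbols. *)

(** * Derivatives along directions *)

(** [class_C] speaks of directional derivatives only: linearity in the direction, the chain rule and
    the symmetry of second derivatives are not built in. They are recovered from the continuity of
    partial derivatives by the mean value theorem, and [findim] supplies the bases for this. The
    Chern symbols correct d_x g by the fibre derivative of g along N(x), that is, by a term 2 C(.,
    ., N(x)). Once Gamma(x, y) = N(x) is known, this correction is exactly the Cartan term of nabla
    g. For uniqueness, alternating three copies of the homogeneous system as in the Koszul formula
    isolates 2 g(T(X, Y), Z) up to Cartan terms, each of which contains some T(., V). Placing v in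
    another slot kills them, because C_v(v, ., .) = 0; this dictates the order T(V, V), T(X, V),
    T(X, Y). Torsion and nabla g are tested on global fields only, so tangent vectors must first be
    extended: the bump functions serve here too, and the Hausdorff property makes the extension by
    zero smooth. *)

Class findim (R : realType) (V : normedModType R) := Findim {
  fdim : nat ;
  bvec : 'I_fdim -> V ;
  bcoo : 'I_fdim -> V -> R ;
  bcooP : forall i a u v, bcoo i (a *: u + v) = a * bcoo i u + bcoo i v ;
  bcoo_cont : forall i, continuous (bcoo i) ;
  bsum : forall v, v = \sum_i bcoo i v *: bvec i }.

Arguments fdim {R} V {findim}.

#[global] Instance findim_R (R : realType) : @findim R R.
Proof.
refine (@Findim R R 1 (fun _ => 1) (fun _ x => x) _ _ _) => //.
  by move=> _ x; exact: cvg_id.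
by move=> v; rewrite big_ord1 [RHS]mulr1.
Defined.

#[global] Instance findim_rV (R : realType) n : @findim R 'rV[R]_n.
Proof.
refine (@Findim R _ n (fun i => delta_mx 0 i) (fun i x => x 0 i) _ _ _).
- by move=> i a u v; rewrite !mxE.
- by move=> i x; exact: coord_continuous.
- by move=> v; exact: row_sum_delta.
Defined.

#[global] Instance findim_prod (R : realType) (V W : normedModType R)
  (bV : findim V) (bW : findim W) : @findim R (V * W)%type.
Proof.
refine (@Findim R _ (fdim V + fdim W)
  (fun i => match fintype.split i with inl j => (bvec j, 0) | inr j => (0, bvec j) end)
  (fun i x => match fintype.split i with inl j => bcoo j x.1 | inr j => bcoo j x.2 end)
  _ _ _).
- by move=> i a u v /=; case: (fintype.split i) => j; rewrite bcooP.
- move=> i; case: (fintype.split i) => j x.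
    by apply: (@continuous_comp _ _ _ fst); [exact: cvg_fst | exact: bcoo_cont].
  by apply: (@continuous_comp _ _ _ snd); [exact: cvg_snd | exact: bcoo_cont].
- move=> [v w] /=; rewrite big_split_ord /=.
  under eq_bigr => i _ do rewrite (unsplitK (inl i)).
  under [X in _ = _ + X]eq_bigr => i _ do rewrite (unsplitK (inr i)).
  have E1 (s : seq 'I_(fdim V)) :
      \sum_(i <- s) bcoo i v *: ((bvec i, 0) : V * W) =
      (\sum_(i <- s) bcoo i v *: bvec i, 0).
    elim: s => [|i s IH]; first by rewrite !big_nil.
    by rewrite !big_cons IH; congr (_, _); rewrite /= scaler0 addr0.
  have E2 (s : seq 'I_(fdim W)) :
      \sum_(i <- s) bcoo i w *: ((0, bvec i) : V * W) =
      (0, \sum_(i <- s) bcoo i w *: bvec i).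
    elim: s => [|i s IH]; first by rewrite !big_nil.
    by rewrite !big_cons IH; congr (_, _); rewrite /= scaler0 addr0.
  rewrite E1 E2; rewrite [v in LHS]bsum [w in LHS]bsum.
  by congr (_, _); rewrite /= ?addr0 ?add0r.
Defined.

(** * Mean value theorem on segments and difference quotients with a moving base point *)

Section Quotient.
Variables (R : realType) (V : normedModType R).

Lemma line_quotientE (W : normedModType R) (f : V -> W) (x e : V) (t : R) :
  (fun h : R => h^-1 *: (((fun s : R => f (x + s *: e)) \o shift t) (h *: (1 : R))
     - f (x + t *: e))) =
  (fun h : R => h^-1 *: ((f \o shift (x + t *: e)) (h *: e) - f (x + t *: e))).
Proof.
apply/funext => h /=; congr (_ *: (f _ - _)).
by rewrite [h *: 1]mulr1 scalerDl addrCA.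
Qed.

Lemma derivable_line (W : normedModType R) (f : V -> W) (x e : V) (t : R) :
  derivable (fun s : R => f (x + s *: e)) t 1 = derivable f (x + t *: e) e.
Proof. by rewrite /derivable line_quotientE. Qed.

Lemma derive_line (W : normedModType R) (f : V -> W) (x e : V) (t : R) :
  'D_1 (fun s : R => f (x + s *: e)) t = 'D_e f (x + t *: e).
Proof. by rewrite /derive line_quotientE. Qed.

(** Bounding [c] through absolute values lets one statement serve both signs of [s]: the
    one-variable theorem is applied on [0, s] or on [s, 0]. *)
Lemma segment_mvt (f : V -> R) (x e : V) (s : R) :
  (forall c, `|c| <= `|s| -> derivable f (x + c *: e) e) ->
  exists2 c, `|c| <= `|s| & f (x + s *: e) - f x = s * 'D_e f (x + c *: e).
Proof.
move=> df.
pose h (t : R) := f (x + t *: e); pose dh (t : R) := 'D_e f (x + t *: e).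
have hd (t : R) : `|t| <= `|s| -> derivable h t 1.
  by rewrite derivable_line; exact: df.
have hdd (t : R) : `|t| <= `|s| -> is_derive t 1 h (dh t).
  by move=> ts; apply: DeriveDef; [exact: hd | rewrite derive_line].
have [s0|s0] := leP 0 s.
  have inS (t : R) : t \in `[0, s] -> `|t| <= `|s|.
    by rewrite in_itv /= => /andP[t0 ts]; rewrite !ger0_norm.
  have [||c cs E] := @MVT_segment R h dh 0 s s0.
  - move=> t ts; apply/hdd/inS.
    by move: ts; rewrite !in_itv /= => /andP[/ltW -> /ltW ->].
  - by apply: derivable_within_continuous => t /inS/hd.
  exists c; first exact: inS.
  by rewrite mulrC -/(dh c) -[X in _ * X]subr0 -E /h scale0r addr0.
have inS (t : R) : t \in `[s, 0] -> `|t| <= `|s|.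
  by rewrite in_itv /= => /andP[t0 ts]; rewrite !ler0_norm ?lerN2// ltW.
have [||c cs E] := @MVT_segment R h dh s 0 (ltW s0).
- move=> t ts; apply/hdd/inS.
  by move: ts; rewrite !in_itv /= => /andP[/ltW -> /ltW ->].
- by apply: derivable_within_continuous => t /inS/hd.
exists c; first exact: inS.
apply: oppr_inj; rewrite opprB mulrC -mulrN -[X in _ * X]add0r -/(dh c) -E.
by rewrite /h scale0r addr0.
Qed.

(** A strict form of differentiability along [e]: the base point [q t] moves with [t]. The freedom
    is needed in [quotient_sum_cvg], where each increment starts where the previous one stopped. By
    the mean value theorem the quotient is [a t] times a value of ['D_e f] at a point tending to
    [y]. *)
Lemma quotient_cvg (U : set V) (f : V -> R) (y e : V) (q : R -> V) (a : R -> R)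
    (a0 : R) :
  open U -> U y -> (forall x, U x -> derivable f x e) ->
  {for y, continuous ('D_e f)} ->
  q @ 0^' --> y -> a @ 0^' --> a0 ->
  (fun t => t^-1 * (f (q t + (t * a t) *: e) - f (q t))) @ 0^' -->
    a0 * 'D_e f y.
Proof.
move=> oU Uy df cdf qy aa.
have t0 : (fun t : R => t) @ 0^' --> (0 : R) by exact: nbhs_dnbhs.
have s0 : (fun t => `|t * a t| * `|e|) @ 0^' --> (0 : R).
  rewrite (_ : nbhs 0 = nbhs (`|0 * a0| * `|e|)); last by rewrite mul0r normr0 mul0r.
  by apply: cvgM; [apply: cvg_norm; exact: (cvgM t0 aa) | exact: cvg_cst].
have [r r0 rU] : exists2 r : R, 0 < r & ball y r `<=` U.
  by have /nbhs_ballP[r r0 rU] := open_nbhs_nbhs (conj oU Uy); exists r.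
have small eps : 0 < eps -> \forall t \near 0^', `|t * a t| * `|e| < eps.
  move=> eps0; move/cvgrPdist_lt : s0 => /(_ _ eps0); apply: filterS => t.
  by rewrite sub0r normrN => /(le_lt_trans (ler_norm _)).
pose good t := forall c, `|c| <= `|t * a t| -> U (q t + c *: e).
have gd : \forall t \near 0^', good t.
  near=> t => c cs; apply: rU; rewrite -ball_normE /ball_ /=.
  rewrite opprD addrA (le_lt_trans (ler_normB _ _)) // (splitr r) ltrD //.
    by near: t; move/cvgrPdist_lt : qy; apply; rewrite divr_gt0.
  rewrite normrZ (le_lt_trans (ler_wpM2r _ cs)) //.
  by near: t; apply: small; rewrite divr_gt0.
(* The intermediate point is chosen for every [t], with default 0 when the segment leaves [U]: the
   bound then holds everywhere and gives [qc], while the equation holds for all [t] close to 0. *)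
have /choice[c cP] : forall t, exists c, `|c| <= `|t * a t| /\
    (good t -> f (q t + (t * a t) *: e) - f (q t) =
       (t * a t) * 'D_e f (q t + c *: e)).
  move=> t; have [g|g] := pselect (good t); last by exists 0; rewrite normr0.
  have [|c cs E] := @segment_mvt f (q t) e (t * a t).
    by move=> c cs; apply: df; exact: g.
  by exists c.
have qc : (fun t => q t + c t *: e) @ 0^' --> y.
  rewrite -[y]addr0; apply: cvgD => //; apply/cvgrPdist_lt => eps eps0.
  near=> t; rewrite sub0r normrN normrZ.
  by rewrite (le_lt_trans (ler_wpM2r _ (cP t).1)) //; near: t; exact: small.
have dc : (fun t => a t * 'D_e f (q t + c t *: e)) @ 0^' --> a0 * 'D_e f y.
  by apply: cvgM => //; exact: (cvg_comp _ _ qc cdf).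
apply: cvg_trans dc; apply: near_eq_cvg; near=> t.
have t_neq0 : t != 0 by near: t; exact: nbhs_dnbhs_neq.
have [_ ->] := cP t; last by near: t.
by rewrite -mulrA mulKf.
Unshelve. all: by end_near. Qed.

End Quotient.

Section Derive.
Variables (R : realType).
Implicit Types (V W : normedModType R).

Lemma bcooD V {bV : findim V} i (u v : V) : bcoo i (u + v) = bcoo i u + bcoo i v.
Proof. by rewrite -[u]scale1r bcooP mul1r scale1r. Qed.

Lemma bcoo0 V {bV : findim V} i : bcoo i (0 : V) = 0.
Proof. by apply: (addrI (bcoo i (0 : V))); rewrite -bcooD !addr0. Qed.

Lemma bcooZ V {bV : findim V} i a (u : V) : bcoo i (a *: u) = a * bcoo i u.
Proof. by rewrite -[a *: u]addr0 bcooP bcoo0 addr0. Qed.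

Lemma bcooB V {bV : findim V} i (u v : V) : bcoo i (u - v) = bcoo i u - bcoo i v.
Proof. by rewrite -scaleN1r bcooD bcooZ mulN1r. Qed.

Lemma bcoo_sum V (bV : findim V) i (I : Type) (s : seq I) (u : I -> V) :
  bcoo i (\sum_(j <- s) u j) = \sum_(j <- s) bcoo i (u j).
Proof. by elim: s => [|j s IH]; rewrite ?big_nil ?bcoo0 // !big_cons bcooD IH. Qed.

Lemma cvg_sumr V T (F : set_system T) (I : Type) (s : seq I) (f : I -> T -> V)
    (a : I -> V) :
  Filter F -> (forall i, f i @ F --> a i) ->
  (fun t => \sum_(i <- s) f i t) @ F --> \sum_(i <- s) a i.
Proof. by move=> FF fa; apply: cvg_big => //; exact: add_continuous. Qed.

Lemma is_derive_cvgP V W (f : V -> W) x v df :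
  is_derive x v f df <->
  (fun h : R => h^-1 *: (f (h *: v + x) - f x)) @ 0^' --> df.
Proof.
split=> [[fx <-]|fx]; first exact: fx.
by split; [apply/cvg_ex; exists df | exact: cvg_lim].
Qed.

Lemma is_derive_bcoo V W {bW : findim W} (f : V -> W) x v df i :
  is_derive x v f df -> is_derive x v (fun z => bcoo i (f z)) (bcoo i df).
Proof.
move=> /is_derive_cvgP fx; apply/is_derive_cvgP.
have := cvg_comp _ _ fx (bcoo_cont (findim := bW) (i := i) (x := df)).
by apply: cvg_trans; apply: near_eq_cvg; near=> h; rewrite /= bcooZ bcooB.
Unshelve. all: by end_near. Qed.

Lemma is_derive_vec_sum V W {bW : findim W} (f : V -> W) x v
    (d : 'I_(fdim W) -> R) :
  (forall i, is_derive x v (fun z => bcoo i (f z)) (d i)) ->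
  is_derive x v f (\sum_i d i *: bvec i).
Proof.
move=> fx; apply/is_derive_cvgP.
have -> : (fun h : R => h^-1 *: (f (h *: v + x) - f x)) =
    (fun h => \sum_i (h^-1 * (bcoo i (f (h *: v + x)) - bcoo i (f x))) *: bvec i).
  by apply/funext => h; rewrite [LHS]bsum; under eq_bigr do rewrite bcooZ bcooB.
apply: cvg_sumr => i.
by apply: cvgZr_tmp; exact: (is_derive_cvgP _ _ _ _).1 (fx i).
Qed.

Lemma is_derive_vec V W {bW : findim W} (f : V -> W) x v df :
  (forall i : 'I_(fdim W), is_derive x v (fun z => bcoo i (f z)) (bcoo i df)) ->
  is_derive x v f df.
Proof. by move=> fx; rewrite [df]bsum; exact: is_derive_vec_sum. Qed.

Lemma continuous_vec (T : topologicalType) W {bW : findim W} (f : T -> W) x :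
  (forall i : 'I_(fdim W), {for x, continuous (fun z => bcoo i (f z))}) ->
  {for x, continuous f}.
Proof.
move=> fx; rewrite /prop_for /continuous_at.
rewrite (_ : f = (fun h => \sum_i bcoo i (f h) *: bvec i)); last first.
  by apply/funext => h; rewrite -bsum.
apply: (@cvg_sumr _ _ _ _ _ (fun i h => bcoo i (f h) *: bvec i)
  (fun i => bcoo i (f x) *: bvec i)) => i.
by apply: cvgZr_tmp; exact: fx.
Qed.

Lemma continuous_bcoo (T : topologicalType) W {bW : findim W} (f : T -> W) x i :
  {for x, continuous f} -> {for x, continuous (fun z => bcoo i (f z))}.
Proof. by move=> fx; apply: (@continuous_comp _ _ _ f (bcoo i)) => //; exact: bcoo_cont. Qed.

(** Telescoping along the basis directions listed in [s]. The first increment shifts the base point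
    from [q] to [q'], which still tends to [y]; this is why the induction must hold for every
    [q]. *)
Lemma quotient_sum_cvg V {bV : findim V} (U : set V) (f : V -> R) (y : V)
    (w : R -> V) (w0 : V) (s : seq 'I_(fdim V)) (q : R -> V) :
  open U -> class_C 1 U f -> U y -> w @ 0^' --> w0 -> q @ 0^' --> y ->
  (fun t => t^-1 * (f (q t + \sum_(i <- s) (t * bcoo i (w t)) *: bvec i)
     - f (q t))) @ 0^' --> \sum_(i <- s) bcoo i w0 * 'D_(bvec i) f y.
Proof.
move=> oU [_ fU] Uy ww0.
have t0 : (fun t : R => t) @ 0^' --> (0 : R) by exact: nbhs_dnbhs.
have wi i : (fun t => bcoo i (w t)) @ 0^' --> bcoo i w0.
  exact: (cvg_comp _ _ ww0 (bcoo_cont (i := i) (x := w0))).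
elim: s q => [|i s IH] q qy.
  rewrite big_nil; under eq_fun do rewrite big_nil addr0 subrr mulr0.
  exact: cvg_cst.
rewrite big_cons; under eq_fun do rewrite big_cons.
pose q' t := q t + (t * bcoo i (w t)) *: bvec i.
have qy' : q' @ 0^' --> y.
  rewrite -[y]addr0; apply: cvgD => //.
  rewrite -(scale0r (bvec i)); apply: cvgZr_tmp.
  by have /(_ _) := cvgM t0 (wi i); rewrite mul0r; exact.
have [dfi [cfi _]] := fU (bvec i).
have /(_ _) := cvgD (quotient_cvg oU Uy dfi (cfi y Uy) qy (wi i)) (IH q' qy').
apply: cvg_trans; apply: near_eq_cvg; near=> t => /=.
by rewrite [LHS]addrC -mulrDr /q' subrKA addrA.
Unshelve. all: by end_near. Qed.

(** The direction [w t] is allowed to vary: in the chain rule it will be the difference quotient of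
    the inner function. *)
Lemma quotient_vec_cvg V {bV : findim V} (U : set V) (f : V -> R) (y : V)
    (w : R -> V) (w0 : V) :
  open U -> class_C 1 U f -> U y -> w @ 0^' --> w0 ->
  (fun t => t^-1 * (f (y + t *: w t) - f y)) @ 0^' -->
    \sum_i bcoo i w0 * 'D_(bvec i) f y.
Proof.
move=> oU fU Uy ww0.
have cy : (fun _ : R => y) @ 0^' --> y by exact: cvg_cst.
apply: (cvg_trans _ (quotient_sum_cvg (s := index_enum _) oU fU Uy ww0 cy)).
apply: near_eq_cvg; near=> t => /=.
rewrite [X in y + t *: X]bsum scaler_sumr.
by under [in RHS]eq_bigr do rewrite scalerA.
Unshelve. all: by end_near. Qed.

Lemma derive_bsum_scalar V {bV : findim V} (U : set V) (f : V -> R) (y w : V) :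
  open U -> class_C 1 U f -> U y ->
  'D_w f y = \sum_i bcoo i w * 'D_(bvec i) f y.
Proof.
move=> oU fU Uy; apply: cvg_lim => //.
have cw : (fun _ : R => w) @ 0^' --> w by exact: cvg_cst.
apply: (cvg_trans _ (quotient_vec_cvg oU fU Uy cw)); apply: near_eq_cvg; near=> t => /=.
by rewrite [y + _]addrC.
Unshelve. all: by end_near. Qed.

Lemma derive_bcoo V W {bW : findim W} (f : V -> W) x v i :
  derivable f x v -> 'D_v (fun z => bcoo i (f z)) x = bcoo i ('D_v f x).
Proof. by move=> /derivableP fx; have [] := is_derive_bcoo i fx. Qed.

Lemma near_open V (U : set V) (P : V -> Prop) x :
  open U -> U x -> (forall y, U y -> P y) -> \near x, P x.
Proof. by move=> oU Ux UP; exact: (filterS UP (open_nbhs_nbhs (conj oU Ux))). Qed.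

Lemma continuous_near_eq (T : topologicalType) (T' : topologicalType)
    (f g : T -> T') x :
  (\near x, f x = g x) -> {for x, continuous f} -> {for x, continuous g}.
Proof.
move=> fg; rewrite /prop_for /continuous_at -(nbhs_singleton fg).
by apply: cvg_trans; apply: near_eq_cvg; apply: filterS fg.
Qed.

Lemma class_C_eq V W k (U : set V) (f g : V -> W) :
  open U -> (forall x, U x -> f x = g x) -> class_C k U f -> class_C k U g.
Proof.
move=> oU; elim: k f g => [|k IH] f g fg [cf df].
  split=> // x Ux; apply: continuous_near_eq (cf x Ux).
  exact: (near_open oU Ux).
split=> [x Ux|v]; first by apply: continuous_near_eq (cf x Ux); exact: (near_open oU Ux).
have [dfv Cfv] := df v; split=> [x Ux|].
  by apply: near_eq_derivable (dfv x Ux); exact: (near_open oU Ux).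
apply: IH Cfv => x Ux; apply: near_eq_derive; exact: (near_open oU Ux).
Qed.

Lemma class_C_sub V W k (U U' : set V) (f : V -> W) :
  U' `<=` U -> class_C k U f -> class_C k U' f.
Proof.
move=> sU; elim: k f => [|k IH] f [cf df]; first by split=> // x /sU/cf.
split=> [x /sU/cf //|v]; have [dfv Cfv] := df v.
by split=> [x /sU/dfv //|]; exact: IH.
Qed.

Lemma class_C_local V W k (U : set V) (f : V -> W) :
  (forall x, U x -> exists2 U' : set V, U' x & class_C k U' f) -> class_C k U f.
Proof.
elim: k f => [|k IH] f loc.
  by split=> // x /loc[U' U'x [cf _]]; exact: cf.
split=> [x /loc[U' U'x [cf _]]|v]; first exact: cf.
split=> [x /loc[U' U'x [_ /(_ v)[dfv _]]]|]; first exact: dfv.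
by apply: IH => x /loc[U' U'x [_ /(_ v)[_ Cfv]]]; exists U'.
Qed.

Lemma class_CW V W k (U : set V) (f : V -> W) :
  class_C k.+1 U f -> class_C k U f.
Proof.
elim: k f => [|k IH] f [cf df]; first by split.
by split=> // v; have [dfv Cfv] := df v; split=> //; exact: IH.
Qed.

Lemma class_C_le V W k l (U : set V) (f : V -> W) :
  (k <= l)%N -> class_C l U f -> class_C k U f.
Proof.
move=> /subnK <-; elim: (l - k)%N => // m IH Cf; apply: IH.
by apply: class_CW; rewrite -addSn.
Qed.

Lemma class_C_bcoo V W {bW : findim W} k (U : set V) (f : V -> W) i :
  open U -> class_C k U f -> class_C k U (fun z => bcoo i (f z)).
Proof.
move=> oU; elim: k f => [|k IH] f [cf df].
  by split=> // x /cf; exact: continuous_bcoo.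
split=> [x /cf|v]; first exact: continuous_bcoo.
have [dfv Cfv] := df v; split=> [x /dfv/derivableP fx|].
  by have [] := is_derive_bcoo i fx.
apply: class_C_eq (IH _ Cfv) => // x Ux.
by rewrite derive_bcoo //; exact: dfv.
Qed.

Lemma class_C_vec V W {bW : findim W} k (U : set V) (f : V -> W) :
  open U -> (forall i : 'I_(fdim W), class_C k U (fun z => bcoo i (f z))) ->
  class_C k U f.
Proof.
move=> oU; elim: k f => [|k IH] f Cf.
  split=> // x Ux; apply: continuous_vec => i.
  by have [+ _] := Cf i; exact.
split=> [x Ux|v]; first by apply: continuous_vec => i; have [+ _] := Cf i; exact.
have df x : U x -> derivable f x v.
  move=> Ux; have fi (i : 'I_(fdim W)) :
      is_derive x v (fun z => bcoo i (f z)) ('D_v (fun z => bcoo i (f z)) x).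
    by apply: derivableP; have [_ /(_ v)[+ _]] := Cf i; exact.
  by have [] := is_derive_vec_sum fi.
split=> //; apply: IH => i.
have [_ /(_ v)[_]] := Cf i; apply: class_C_eq => // x Ux.
by rewrite derive_bcoo //; exact: df.
Qed.

Lemma derive_bsum V W {bV : findim V} {bW : findim W} (U : set V) (f : V -> W) (y w : V) :
  open U -> class_C 1 U f -> U y ->
  'D_w f y = \sum_i bcoo i w *: 'D_(bvec i) f y.
Proof.
move=> oU fU Uy; have [_ dfU] := fU.
rewrite [LHS]bsum [RHS]bsum; apply: eq_bigr => j _; congr (_ *: _).
rewrite -derive_bcoo; last by have [+ _] := dfU w; exact.
rewrite (derive_bsum_scalar w oU (class_C_bcoo j oU fU) Uy) bcoo_sum.
apply: eq_bigr => i _; rewrite bcooZ derive_bcoo //.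
by have [+ _] := dfU (bvec i); exact.
Qed.

(** The increment of [g] is [t] times its difference quotient, which tends to [dg]; this quotient is
    the varying direction fed to [quotient_vec_cvg], coordinate by coordinate. *)
Lemma is_derive_comp (T : normedModType R) V W {bV : findim V} {bW : findim W} (U : set V)
    (f : V -> W) (g : T -> V) (x v : T) dg :
  open U -> class_C 1 U f -> U (g x) -> is_derive x v g dg ->
  is_derive x v (f \o g) ('D_dg f (g x)).
Proof.
move=> oU fU Ug gx.
apply: is_derive_vec => i; set fi := fun z => bcoo i (f z).
have fiU : class_C 1 U fi by exact: class_C_bcoo oU fU.
rewrite -derive_bcoo; last by have [_ /(_ dg)[+ _]] := fU; exact.
apply/is_derive_cvgP; rewrite (derive_bsum_scalar dg oU fiU Ug).
move/is_derive_cvgP : gx => gx.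
apply: (cvg_trans _ (quotient_vec_cvg oU fiU Ug gx)); apply: near_eq_cvg; near=> t => /=.
have t0 : t != 0 by near: t; exact: nbhs_dnbhs_neq.
by rewrite scalerA divff // scale1r [g x + _]addrC subrK.
Unshelve. all: by end_near. Qed.

End Derive.

(** * Closure properties of the functions of class C^k *)

Section ClassC.
Variables (R : realType).
Implicit Types (V W : normedModType R).

Lemma deriveZdir V W {bV : findim V} {bW : findim W} (U : set V) (f : V -> W)
    (y u : V) (a : R) :
  open U -> class_C 1 U f -> U y -> 'D_(a *: u) f y = a *: 'D_u f y.
Proof.
move=> oU fU Uy; rewrite !(derive_bsum _ oU fU Uy) scaler_sumr.
by apply: eq_bigr => i _; rewrite bcooZ scalerA.
Qed.

Lemma deriveDdir V W {bV : findim V} {bW : findim W} (U : set V) (f : V -> W)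
    (y u v : V) :
  open U -> class_C 1 U f -> U y -> 'D_(u + v) f y = 'D_u f y + 'D_v f y.
Proof.
move=> oU fU Uy; rewrite !(derive_bsum _ oU fU Uy) -big_split.
by apply: eq_bigr => i _; rewrite bcooD scalerDl.
Qed.

Lemma class_C_derivable V W k (U : set V) (f : V -> W) x v :
  class_C k.+1 U f -> U x -> derivable f x v.
Proof. by move=> [_ /(_ v)[+ _]]; exact. Qed.
Arguments class_C_derivable {V W k U f x} v.

Lemma class_C_cont V W k (U : set V) (f : V -> W) x :
  class_C k U f -> U x -> {for x, continuous f}.
Proof. by case: k => [|k] [+ _]; exact. Qed.

Lemma class_C_derive V W k (U : set V) (f : V -> W) v :
  class_C k.+1 U f -> class_C k U ('D_v f).
Proof. by move=> [_ /(_ v)[]]. Qed.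
Arguments class_C_derive {V W k U f} v.

Lemma class_C_cst V W k (U : set V) (a : W) : class_C k U (fun _ : V => a).
Proof.
elim: k a => [|k IH] a; first by split=> // x _; exact: cst_continuous.
split=> [x _|v]; first exact: cst_continuous.
split=> [x _|]; first exact: derivable_cst.
rewrite (_ : 'D_v _ = (fun=> 0)) //; apply/funext => x; exact: derive_cst.
Qed.

Arguments class_C_cst {V W k U} a.

Lemma class_C_add V W k (U : set V) (f g : V -> W) :
  open U -> class_C k U f -> class_C k U g -> class_C k U (fun z => f z + g z).
Proof.
move=> oU; elim: k f g => [|k IH] f g [cf df] [cg dg].
  by split=> // x Ux; apply: continuousD; [exact: cf | exact: cg].
split=> [x Ux|v]; first by apply: continuousD; [exact: cf | exact: cg].
have [dfv Cfv] := df v; have [dgv Cgv] := dg v.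
split=> [x Ux|]; first exact: derivableD (dfv _ Ux) (dgv _ Ux).
apply: class_C_eq (IH _ _ Cfv Cgv) => // x Ux.
by rewrite [RHS](deriveD (dfv _ Ux) (dgv _ Ux)).
Qed.

Lemma class_C_mul V k (U : set V) (f g : V -> R) :
  open U -> class_C k U f -> class_C k U g -> class_C k U (fun z => f z * g z).
Proof.
move=> oU; elim: k f g => [|k IH] f g Cf Cg.
  by split=> // x Ux; exact: continuousM (class_C_cont Cf Ux) (class_C_cont Cg Ux).
split=> [x Ux|v]; first exact: continuousM (class_C_cont Cf Ux) (class_C_cont Cg Ux).
have dfv x := fun Ux : U x => class_C_derivable v Cf Ux.
have dgv x := fun Ux : U x => class_C_derivable v Cg Ux.
split=> [x Ux|]; first exact: derivableM (dfv _ Ux) (dgv _ Ux).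
have := class_C_add oU (IH _ _ (class_CW Cf) (class_C_derive v Cg))
  (IH _ _ (class_CW Cg) (class_C_derive v Cf)).
apply: class_C_eq => // x Ux.
by rewrite [RHS](deriveM (dfv _ Ux) (dgv _ Ux)).
Qed.

Lemma class_C_inv V k (U : set V) (f : V -> R) :
  open U -> (forall x, U x -> f x != 0) -> class_C k U f ->
  class_C k U (fun z => (f z)^-1).
Proof.
move=> oU f0; elim: k => [|k IH] Cf.
  by split=> // x Ux; exact: continuousV (f0 _ Ux) (class_C_cont Cf Ux).
split=> [x Ux|v].
  exact: continuousV (f0 _ Ux) (class_C_cont Cf Ux).
have dfv x := fun Ux : U x => class_C_derivable v Cf Ux.
split=> [x Ux|]; first exact: derivableV (f0 _ Ux) (dfv _ Ux).
(* The derivative of 1/f is -(1/f)^2 Df, so only the order [k] of 1/f enters, and the induction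
   hypothesis provides it. *)
have C1 := IH (class_CW Cf).
have C2 := class_C_mul oU (class_C_mul oU (class_C_cst (- 1 : R))
  (class_C_mul oU C1 C1)) (class_C_derive v Cf).
apply: class_C_eq C2 => // x Ux.
rewrite [RHS](deriveV (f0 _ Ux) (dfv _ Ux)).
by rewrite mulN1r -expr2 exprVn.
Qed.

Lemma class_C_scale V W {bW : findim W} k (U : set V) (a : V -> R) (f : V -> W) :
  open U -> class_C k U a -> class_C k U f -> class_C k U (fun z => a z *: f z).
Proof.
move=> oU Ca Cf; apply: class_C_vec => // i.
rewrite (_ : (fun z => _) = (fun z => a z * bcoo i (f z))).
  by apply: class_C_mul => //; exact: class_C_bcoo.
by apply/funext => z; rewrite bcooZ.
Qed.

Lemma class_C_sum V W k (U : set V) (I : Type) (s : seq I) (P : pred I)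
    (f : I -> V -> W) :
  open U -> (forall i, class_C k U (f i)) ->
  class_C k U (fun z => \sum_(i <- s | P i) f i z).
Proof.
move=> oU Cf; elim: s => [|i s IH].
  rewrite (_ : (fun z => _) = (fun=> 0)); first exact: class_C_cst.
  by apply/funext => z; rewrite big_nil.
case Pi: (P i).
  rewrite (_ : (fun z => _) = (fun z => f i z + \sum_(j <- s | P j) f j z)).
    exact: class_C_add.
  by apply/funext => z; rewrite big_cons Pi.
rewrite (_ : (fun z => _) = (fun z => \sum_(j <- s | P j) f j z)) //.
by apply/funext => z; rewrite big_cons Pi.
Qed.

Lemma class_C_prod V k (U : set V) (I : Type) (s : seq I) (P : pred I)
    (f : I -> V -> R) :
  open U -> (forall i, class_C k U (f i)) ->
  class_C k U (fun z => \prod_(i <- s | P i) f i z).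
Proof.
move=> oU Cf; elim: s => [|i s IH].
  rewrite (_ : (fun z => _) = (fun=> 1)); first exact: class_C_cst.
  by apply/funext => z; rewrite big_nil.
case Pi: (P i).
  rewrite (_ : (fun z => _) = (fun z => f i z * \prod_(j <- s | P j) f j z)).
    exact: class_C_mul.
  by apply/funext => z; rewrite big_cons Pi.
rewrite (_ : (fun z => _) = (fun z => \prod_(j <- s | P j) f j z)) //.
by apply/funext => z; rewrite big_cons Pi.
Qed.

Lemma derive_linear V W (l : V -> W) x v :
  (forall a u v, l (a *: u + v) = a *: l u + l v) -> is_derive x v l (l v).
Proof.
move=> ll; apply/is_derive_cvgP.
have : (fun _ : R => l v) @ 0^' --> l v by exact: cvg_cst.
apply: cvg_trans.
apply: near_eq_cvg; near=> h.
have h0 : h != 0 by near: h; exact: nbhs_dnbhs_neq.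
by rewrite ll addrK scalerA mulVf // scale1r.
Unshelve. all: by end_near. Qed.

Lemma class_C_linear V W k (U : set V) (l : V -> W) :
  (forall a u v, l (a *: u + v) = a *: l u + l v) -> continuous l ->
  class_C k U l.
Proof.
move=> ll cl; case: k => [|k]; first by split=> // x _; exact: cl.
split=> [x _|v]; first exact: cl.
split=> [x _|]; first by have [] := derive_linear x v ll.
rewrite (_ : 'D_v l = (fun=> l v)); first exact: class_C_cst.
by apply/funext => x; have [] := derive_linear x v ll.
Qed.

(** Here the direction [h x] varies as well; expanding it over the basis leaves fixed directions
    only. Regularity is assumed of the functions ['D_(bvec i) f (g x)] rather than of [f], so that
    the lemma can serve inside the induction of [class_C_comp]. *)
Lemma class_C_derive_comp (T : normedModType R) V W {bV : findim V}
    {bW : findim W} k (U : set V) (U' : set T) (f : V -> W) (g h : T -> V) :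
  open U -> open U' -> (forall x, U' x -> U (g x)) -> class_C 1 U f ->
  (forall i, class_C k U' (fun x => 'D_(bvec i) f (g x))) -> class_C k U' h ->
  class_C k U' (fun x => 'D_(h x) f (g x)).
Proof.
move=> oU oU' UU' fU Cf Ch.
have : class_C k U' (fun x => \sum_i bcoo i (h x) *: 'D_(bvec i) f (g x)).
  by apply: class_C_sum => // i; apply: class_C_scale => //; exact: class_C_bcoo.
by apply: class_C_eq => // x Ux; rewrite [RHS](derive_bsum _ oU fU (UU' _ Ux)).
Qed.

Lemma class_C_comp (T : normedModType R) V W {bV : findim V} {bW : findim W} k
    (U : set V) (U' : set T) (f : V -> W) (g : T -> V) :
  open U -> open U' -> (forall x, U' x -> U (g x)) ->
  class_C k U f -> class_C k U' g -> class_C k U' (fun x => f (g x)).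
Proof.
move=> oU oU' UU'; elim: k f => [|k IH] f Cf Cg.
  split=> // x Ux; apply: (@continuous_comp _ _ _ g f).
    exact: class_C_cont Cg Ux.
  by apply: class_C_cont Cf _; exact: UU'.
have C1 : class_C 1 U f by exact: class_C_le Cf.
have fg x v : U' x -> is_derive x v (f \o g) ('D_('D_v g x) f (g x)).
  move=> Ux; apply: (is_derive_comp oU C1 (UU' _ Ux)).
  exact/derivableP/(class_C_derivable v Cg Ux).
split=> [x Ux|v].
  apply: (@continuous_comp _ _ _ g f); first exact: class_C_cont Cg Ux.
  by apply: class_C_cont Cf _; exact: UU'.
split=> [x Ux|]; first by have [] := fg x v Ux.
apply: (@class_C_eq _ _ _ _ _ (fun x => 'D_('D_v g x) f (g x))) => //.
  by move=> x Ux; have [] := fg x v Ux.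
apply: (class_C_derive_comp oU oU' UU' C1); last exact: class_C_derive.
by move=> i; exact: IH (class_C_derive (bvec i) Cf) (class_CW Cg).
Qed.

Lemma class_C_pair V W (T : normedModType R) {bW : findim W} {bT : findim T} k
    (U : set V) (f : V -> W) (g : V -> T) :
  open U -> class_C k U f -> class_C k U g -> class_C k U (fun z => (f z, g z)).
Proof.
move=> oU Cf Cg; apply: class_C_vec => // i /=.
by case: (fintype.split i) => j; exact: class_C_bcoo.
Qed.

End ClassC.

Arguments class_C_derivable {R V W k U f x} v.
Arguments class_C_derive {R V W k U f} v.
Arguments class_C_cst {R V W k U} a.

(** * Symmetry of second derivatives *)

Section Schwarz.
Variables (R : realType).
Implicit Types (V W : normedModType R).

Lemma is_derive_shift_arg V W (f : V -> W) (x a v : V) df :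
  is_derive (x + a) v f df -> is_derive x v (fun z => f (z + a)) df.
Proof.
move=> /is_derive_cvgP fx; apply/is_derive_cvgP; move: fx.
by apply: cvg_trans; apply: near_eq_cvg; near=> h; rewrite addrA.
Unshelve. all: by end_near. Qed.

(** The mean value theorem is used twice: along [u] for the increment of [f] by [t *: v], then along
    [v] for ['D_u f]. *)
Lemma second_difference_mvt V (U : set V) (f : V -> R) (y u v : V) (t : R) :
  class_C 2 U f ->
  (forall c d : R, `|c| <= `|t| -> `|d| <= `|t| -> U (y + c *: u + d *: v)) ->
  exists c d : R, [/\ `|c| <= `|t|, `|d| <= `|t| &
    f (y + t *: u + t *: v) - f (y + t *: u) - (f (y + t *: v) - f y) =
    t * t * 'D_v ('D_u f) (y + c *: u + d *: v)].
Proof.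
move=> Cf UU.
have U0 (c : R) : `|c| <= `|t| -> U (y + c *: u).
  by move=> ct; rewrite -[X in U X]addr0 -(scale0r v); apply: UU; rewrite ?normr0.
pose g x := f (x + t *: v) - f x.
have dg (c : R) : `|c| <= `|t| -> is_derive (y + c *: u) u g
    ('D_u f (y + c *: u + t *: v) - 'D_u f (y + c *: u)).
  move=> ct; apply: is_deriveB.
    apply: is_derive_shift_arg; apply: derivableP.
    exact: (class_C_derivable u Cf (UU _ _ ct (lexx _))).
  by apply: derivableP; exact: (class_C_derivable u Cf (U0 _ ct)).
have [|c ct] := @segment_mvt _ _ g y u t.
  by move=> c /dg[].
have [_ ->] := dg _ ct.
have [|d dt ->] := @segment_mvt _ _ ('D_u f) (y + c *: u) v t.
  by move=> d dt; apply: (class_C_derivable v (class_C_derive u Cf)); exact: UU.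
by rewrite mulrA => E; exists c, d; split => //; rewrite -E /g opprB addrACA
  [in RHS]addrAC addrA !addrA.
Qed.

Lemma second_difference_cvg V (U : set V) (f : V -> R) (y u v : V) :
  open U -> class_C 2 U f -> U y ->
  (fun t : R => (t * t)^-1 *
    (f (y + t *: u + t *: v) - f (y + t *: u) - (f (y + t *: v) - f y))) @ 0^'
    --> 'D_v ('D_u f) y.
Proof.
move=> oU Cf Uy.
have [r r0 rU] : exists2 r : R, 0 < r & ball y r `<=` U.
  by have /nbhs_ballP[r r0 rU] := open_nbhs_nbhs (conj oU Uy); exists r.
(* The summand 1 keeps [K] positive even when [u] and [v] vanish, so that one may divide by it. *)
pose K := `|u| + `|v| + 1.
have K0 : 0 < K by rewrite ltr_wpDl // addr_ge0.
have bnd (t c d : R) : `|c| <= `|t| -> `|d| <= `|t| ->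
    `|y - (y + c *: u + d *: v)| <= `|t| * K.
  move=> ct dt; rewrite -addrA opprD addrA subrr add0r normrN.
  rewrite (le_trans (ler_normD _ _)) // !normrZ /K !mulrDr mulr1.
  by rewrite ler_wpDr // lerD // ler_wpM2r.
pose good (t : R) := forall c d : R, `|c| <= `|t| -> `|d| <= `|t| -> U (y + c *: u + d *: v).
have small (eps : R) : 0 < eps -> \forall t \near 0^', `|t| * K < eps.
  move=> e0; near=> t; rewrite -ltr_pdivlMr //.
  by near: t; apply: dnbhs0_lt; rewrite divr_gt0.
have gd : \forall t \near 0^', good t.
  near=> t => c d ct dt; apply: rU; rewrite -ball_normE /ball_ /=.
  by apply: (le_lt_trans (bnd _ _ _ ct dt)); near: t; exact: small.
have /choice[p pP] : forall t : R, exists p : R * R, [/\ `|p.1| <= `|t|, `|p.2| <= `|t| &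
    good t -> f (y + t *: u + t *: v) - f (y + t *: u) - (f (y + t *: v) - f y) =
    t * t * 'D_v ('D_u f) (y + p.1 *: u + p.2 *: v)].
  move=> t; have [g|g] := pselect (good t); last by exists (0, 0); rewrite /= normr0.
  by have [c [d [ct dt E]]] := second_difference_mvt Cf g; exists (c, d).
pose q (t : R) := y + (p t).1 *: u + (p t).2 *: v.
have qy : q @ 0^' --> y.
  apply/cvgrPdist_lt => eps eps0; near=> t.
  have [pt1 pt2 _] := pP t.
  by apply: (le_lt_trans (bnd _ _ _ pt1 pt2)); near: t; exact: small.
have cD := class_C_cont (class_C_derive v (class_C_derive u Cf)) Uy.
have := cvg_comp _ _ qy cD.
apply: cvg_trans; apply: near_eq_cvg; near=> t.
have t0 : t != 0 by near: t; exact: nbhs_dnbhs_neq.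
have [_ _ ->] := pP t; last by near: t.
by rewrite mulKf // mulf_neq0.
Unshelve. all: by end_near. Qed.

(** The second difference is symmetric in [u] and [v], so both mixed derivatives are limits of one
    and the same quotient. *)
Lemma derive_swap V W {bW : findim W} (U : set V) (f : V -> W) (y u v : V) :
  open U -> class_C 2 U f -> U y -> 'D_v ('D_u f) y = 'D_u ('D_v f) y.
Proof.
move=> oU Cf Uy.
have scal (g : V -> R) : class_C 2 U g -> 'D_v ('D_u g) y = 'D_u ('D_v g) y.
  move=> Cg; have guv := second_difference_cvg (u := u) (v := v) oU Cg Uy.
  have := second_difference_cvg (u := v) (v := u) oU Cg Uy.
  rewrite (_ : (fun t : R => _) = (fun t : R => (t * t)^-1 *
    (g (y + t *: u + t *: v) - g (y + t *: u) - (g (y + t *: v) - g y)))).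
    by move/cvg_lim => <- //; move/cvg_lim : guv => <-.
  apply/funext => t; congr (_ * _); rewrite [y + t *: v + _]addrAC.
  ring.
have coo w w' i : bcoo i ('D_w ('D_w' f) y) = 'D_w ('D_w' (fun z => bcoo i (f z))) y.
  rewrite -derive_bcoo; last first.
    exact: class_C_derivable w (class_C_derive w' Cf) Uy.
  apply: near_eq_derive; apply: (near_open oU Uy) => z Uz.
  by rewrite derive_bcoo //; exact: class_C_derivable w' Cf Uz.
rewrite [LHS]bsum [RHS]bsum; apply: eq_bigr => i _; congr (_ *: _).
by rewrite !coo; apply: scal; exact: class_C_bcoo.
Unshelve. all: by end_near. Qed.

End Schwarz.

(** * Bump functions *)

Section Bump.
Variable R : realType.

(** The classical flat function e^(-1/t), multiplied by powers of 1/t to obtain a family whose span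
    is stable under differentiation ([is_derive_flat]); smoothness then follows for all [m] at once
    by induction on the order. *)
Definition flat (m : nat) (t : R) : R :=
  if 0 < t then t^-1 ^+ m * expR (- t^-1) else 0.

Lemma flat_gt0 m t : 0 < t -> 0 < flat m t.
Proof.
by move=> t0; rewrite /flat t0 mulr_gt0 ?expR_gt0 // exprn_gt0 // invr_gt0.
Qed.

Lemma flat_le0 m t : t <= 0 -> flat m t = 0.
Proof. by rewrite /flat ltNge => ->. Qed.

Lemma flat_ge0 m t : 0 <= flat m t.
Proof. by case: (leP t 0) => [/flat_le0-> //|/(flat_gt0 m)/ltW]. Qed.

Lemma flatS m t : t != 0 -> t^-1 * flat m t = flat m.+1 t.
Proof. by rewrite /flat; case: ifP => _ t0; rewrite ?mulr0 // mulrA exprS. Qed.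

(** A single term of the exponential series suffices: with s = 1/t, s^(m+1) / (m+1)! is at most e^s,
    hence s^m e^(-s) is at most (m+1)! t. *)
Lemma flat_bound m t : 0 <= t -> flat m t <= m.+1`!%:R * t.
Proof.
rewrite le_eqVlt => /predU1P[<-|t0]; first by rewrite mulr0 flat_le0.
have s0 : 0 < t^-1 by rewrite invr_gt0.
rewrite /flat t0 expRN ler_pdivrMr ?expR_gt0 //.
have E : t^-1 ^+ m.+1 / m.+1`!%:R <= expR t^-1.
  by rewrite (le_trans _ (expR_ge1Dxn m (ltW s0))) // lerDr.
have F0 : 0 < m.+1`!%:R :> R by rewrite ltr0n fact_gt0.
have -> : t^-1 ^+ m = m.+1`!%:R * t * (t^-1 ^+ m.+1 / m.+1`!%:R).
  by rewrite exprS; field; rewrite !gt_eqF.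
by rewrite ler_wpM2l // mulr_ge0 // ltW.
Qed.

Lemma flat_cvg0 m : flat m x @[x --> (0 : R)] --> (0 : R).
Proof.
apply/cvgrPdist_lt => e e0.
have F0 : 0 < m.+1`!%:R :> R by rewrite ltr0n fact_gt0.
have N : \forall t \near (0 : R), `|t| < e / m.+1`!%:R.
  by apply: pseudometric_normed_Zmodule.nbhs0_lt; rewrite divr_gt0.
apply: filterS N => t tN; rewrite sub0r normrN ger0_norm ?flat_ge0 //.
have [t0|t0] := leP t 0; first by rewrite flat_le0.
rewrite (le_lt_trans (flat_bound m (ltW t0))) // mulrC.
by rewrite -ltr_pdivlMr // (le_lt_trans (ler_norm _)).
Qed.

Lemma is_derive_flat m (t : R) :
  is_derive t 1 (flat m) (flat m.+2 t - m%:R * flat m.+1 t).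
Proof.
have [t0|t0|->] := ltgtP t 0.
- rewrite !flat_le0 ?ltW // mulr0 subr0.
  apply: (near_eq_is_derive (f := cst 0)).
  by apply: filterS (lt_nbhsl t0) => x x0; rewrite flat_le0 // ltW.
- have N : \near t, t^-1 ^+ m * expR (- t^-1) = flat m t.
    by apply: filterS (lt_nbhsr t0) => x x0; rewrite /flat x0.
  apply: (near_eq_is_derive N).
  have tn0 : t != 0 by rewrite gt_eqF.
  have dV : is_derive t 1 (fun x : R => x^-1) (- t ^- 2).
    apply: DeriveDef; first by apply: derivableV.
    by rewrite deriveV // derive_id [LHS]mulr1.
  have dE : is_derive t 1 (fun x : R => expR (- x^-1)) (expR (- t^-1) * - - t ^- 2).
    exact: (@is_derive1_comp _ expR (fun x => - x^-1)).
  have dX : is_derive t 1 (fun x : R => x^-1 ^+ m) ((m%:R * t^-1 ^+ m.-1) * - t ^- 2).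
    rewrite (_ : (fun x => _) = (fun x : R => x^-1) ^+ m).
      exact: is_deriveX.
    by apply/funext => x; rewrite exprfctE.
  apply: is_derive_eq (is_deriveM dX dE) _.
  rewrite /flat t0 /= /GRing.scale /=; clear -tn0; case: m => [|m].
    by rewrite !mul0r expr0 !exprS expr0; field.
  by rewrite !exprS; field.
(* At 0 the difference quotient of [flat m] is [flat m.+1] itself, which tends to 0. *)
- rewrite !flat_le0 // mulr0 subr0; apply/is_derive_cvgP.
  have := cvg_trans (cvg_app (flat m.+1) (@nbhs_dnbhs _ (0 : R))) (@flat_cvg0 m.+1).
  apply: cvg_trans; apply: near_eq_cvg; near=> h.
  rewrite [h *: 1]mulr1 addr0 (flat_le0 _ (lexx 0)) subr0.
  by rewrite -flatS //; near: h; exact: nbhs_dnbhs_neq.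
Unshelve. all: by end_near. Qed.

Lemma derive_dir1 (f : R -> R) (t v df : R) :
  is_derive t 1 f df -> is_derive t v f (v * df).
Proof.
move=> [/derivable1_diffP dft <-]; apply: DeriveDef; first exact: diff_derivable.
by rewrite !deriveE // -[X in 'd f t X = _](mulr1 v) linearZ.
Qed.

Lemma class_C_flat k m (U : set R) : open U -> class_C k U (flat m).
Proof.
move=> oU.
have cf n x : {for x, continuous (flat n)}.
  apply/differentiable_continuous/derivable1_diffP.
  by have [] := is_derive_flat n x.
elim: k m => [|k IH] m; first by split.
split=> [x _ //|v]; split=> [x _|].
  by have [] := derive_dir1 v (is_derive_flat m x).
rewrite (_ : 'D_v _ = (fun t => v * (flat m.+2 t + (- m%:R) * flat m.+1 t))).
  by apply: class_C_mul; [|exact: class_C_cst|apply: class_C_add;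
    [|exact: IH|apply: class_C_mul; [|exact: class_C_cst|exact: IH]]].
apply/funext => x; have [_ ->] := derive_dir1 v (is_derive_flat m x).
by rewrite mulNr.
Qed.

(** The usual quotient a / (a + b), where a is positive exactly for |t| < 1 and b exactly for |t| >
    1/2, so the denominator never vanishes. Squares stand for absolute values to keep smoothness at
    0. *)
Definition cutoff (t : R) : R :=
  flat 0 (1 - t * t) / (flat 0 (1 - t * t) + flat 0 (t * t - 4^-1)).

Lemma cutoff_den_gt0 t : 0 < flat 0 (1 - t * t) + flat 0 (t * t - 4^-1).
Proof.
have [h|h] := ltP (t * t) 1.
  by rewrite ltr_wpDr ?flat_ge0 // flat_gt0 // subr_gt0.
by rewrite ltr_wpDl ?flat_ge0 // flat_gt0 // subr_gt0; lra.
Qed.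

Lemma smooth_cutoff : smooth setT cutoff.
Proof.
move=> k; have oT := @openT R.
have Cid : class_C k setT (fun t : R => t).
  by apply: class_C_linear => // x; exact: cvg_id.
have Csq : class_C k setT (fun t : R => t * t) by exact: class_C_mul.
have C1 : class_C k setT (fun t : R => flat 0 (1 - t * t)).
  apply: (class_C_comp (U := setT)) => //; first exact: class_C_flat.
  apply: class_C_add => //; first exact: class_C_cst.
  rewrite (_ : (fun z => _) = (fun z => (- 1 : R) * (z * z))).
    by apply: class_C_mul => //; exact: class_C_cst.
  by apply/funext => z; rewrite mulN1r.
have C2 : class_C k setT (fun t : R => flat 0 (t * t - 4^-1)).
  apply: (class_C_comp (U := setT)) => //; first exact: class_C_flat.
  by apply: class_C_add => //; exact: class_C_cst.
apply: class_C_mul => //; apply: class_C_inv => //; last exact: class_C_add.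
by move=> x _; rewrite gt_eqF // cutoff_den_gt0.
Qed.

Lemma cutoff1 t : `|t| <= 2^-1 -> cutoff t = 1.
Proof.
rewrite ler_norml => /andP[t1 t2].
have t4 : t * t - 4^-1 <= 0 by nra.
rewrite /cutoff [X in _ / (_ + X)]flat_le0 // addr0 divff //.
by rewrite gt_eqF // flat_gt0 //; nra.
Qed.

Lemma cutoff0 t : 1 <= `|t| -> cutoff t = 0.
Proof.
move=> t1; rewrite /cutoff flat_le0 ?mul0r //.
by move: t1; rewrite ler_normr => /orP[] t1; nra.
Qed.

Lemma bump_exists n (U : set 'rV[R]_n) (x0 : 'rV[R]_n) : open U -> U x0 ->
  exists (chi : 'rV[R]_n -> R) (K : set 'rV[R]_n),
    [/\ smooth setT chi, \forall x \near x0, chi x = 1,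
        compact K, K `<=` U & forall x, ~ K x -> chi x = 0].
Proof.
move=> oU Ux0.
have [r r0 rU] : exists2 r : R, 0 < r & ball x0 r `<=` U.
  by have /nbhs_ballP[r r0 rU] := open_nbhs_nbhs (conj oU Ux0); exists r.
(* Half the radius, so that the closed cube [K] of half-side [s] lies in the open ball of radius
   [r]; the norm on row vectors is the maximum norm. *)
pose s := r / 2; have s0 : 0 < s by rewrite divr_gt0.
pose chi (x : 'rV[R]_n) : R := \prod_i cutoff ((x 0 i - x0 0 i) / s).
pose K := [set x : 'rV[R]_n | forall i, `[x0 0 i - s, x0 0 i + s]%classic (x 0 i)].
have abs_le (x : 'rV[R]_n) i : `|x 0 i| <= `|x|.
  by rewrite [leRHS]/Num.Def.normr /= mx_normrE; apply: le_trans (le_bigmax _ _ (0, i)).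
exists chi, K; split.
- move=> k; apply: class_C_prod => [|i]; first exact: openT.
  apply: (class_C_comp (U := setT)) => //; try exact: openT.
    exact: smooth_cutoff.
  apply: class_C_mul; [exact: openT| |exact: class_C_cst].
  apply: class_C_add; [exact: openT| |exact: class_C_cst].
  apply: class_C_linear; last exact: coord_continuous.
  by move=> a u v; rewrite !mxE.
(* [cutoff] equals 1 up to 1/2 in the variable scaled by [s], whence the radius [s / 2]. *)
- have s20 : 0 < s / 2 by rewrite divr_gt0.
  apply: filterS (nbhsx_ballx x0 _ s20) => x; rewrite -ball_normE /ball_ /= => xs.
  apply: big1 => i _; apply: cutoff1.
  rewrite normrM normfV (gtr0_norm s0) ler_pdivrMr // mulrC -[_ / 2]/(s / 2).
  rewrite ltW // (le_lt_trans _ xs) // distrC.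
  by have := abs_le (x0 - x) i; rewrite !mxE.
- apply: (@rV_compact _ _ (fun i => `[x0 0 i - s, x0 0 i + s]%classic)) => i.
  exact: segment_compact.
- move=> x Kx; apply: rU; rewrite -ball_normE /ball_ /=.
  have : `|x0 - x| <= s.
    rewrite [leLHS]/Num.Def.normr /= mx_normrE; apply: bigmax_le => [|[j i] _].
      exact: ltW.
    rewrite (ord1 j) !mxE /= distrC ler_norml; have := Kx i.
    by rewrite /= in_itv /= => /andP[? ?]; lra.
  by move/le_lt_trans; apply; rewrite /s; lra.
- move=> x /existsNP[i Kxi]; rewrite /chi (bigD1 i) //= cutoff0 ?mul0r //.
  rewrite normrM normfV (gtr0_norm s0) ler_pdivlMr // mul1r leNgt.
  apply/negP; rewrite ltr_norml => /andP[? ?]; apply: Kxi.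
  by rewrite /= in_itv /=; lra.
Qed.

End Bump.

(** * The fundamental tensor in natural coordinates *)

Section Linear.
Variables (R : realType) (n : nat).
Implicit Types (f : 'rV[R]_n -> R).

(** A predicate on bare functions, because forms such as [gm z u] are shown to be linear only for
    [z] in the domain of the metric. *)
Definition lin_form f := forall a u v, f (a *: u + v) = a * f u + f v.

Lemma lin_form0 f : lin_form f -> f 0 = 0.
Proof. by move=> fl; have := fl (-1) 0 0; rewrite scaler0 addr0 => E; lra. Qed.

Lemma lin_formZ f a u : lin_form f -> f (a *: u) = a * f u.
Proof. by move=> fl; rewrite -[a *: u]addr0 fl lin_form0 // addr0. Qed.

Lemma lin_formD f u v : lin_form f -> f (u + v) = f u + f v.
Proof. by move=> fl; rewrite -[u]scale1r fl mul1r scale1r. Qed.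

Lemma lin_formN f u : lin_form f -> f (- u) = - f u.
Proof. by move=> fl; rewrite -scaleN1r lin_formZ // mulN1r. Qed.

Lemma lin_formB f u v : lin_form f -> f (u - v) = f u - f v.
Proof. by move=> fl; rewrite lin_formD // lin_formN. Qed.

Lemma lin_form_sum f (I : Type) (s : seq I) (u : I -> 'rV[R]_n) :
  lin_form f -> f (\sum_(i <- s) u i) = \sum_(i <- s) f (u i).
Proof.
move=> fl; elim: s => [|i s IH]; first by rewrite !big_nil lin_form0.
by rewrite !big_cons lin_formD // IH.
Qed.

Lemma lin_form_basis f u :
  lin_form f -> f u = \sum_i u 0 i * f (delta_mx 0 i).
Proof.
move=> fl; rewrite [u in LHS]row_sum_delta lin_form_sum //.
by apply: eq_bigr => i _; rewrite lin_formZ.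
Qed.

Lemma lin_form_eq f h : lin_form f -> lin_form h ->
  (forall i, f (delta_mx 0 i) = h (delta_mx 0 i)) -> f =1 h.
Proof.
move=> fl hl fh u; rewrite (lin_form_basis u fl) (lin_form_basis u hl).
by apply: eq_bigr => i _; rewrite fh.
Qed.

(** Leibniz rule for a moving form evaluated at a moving vector; expanding [p] in the standard basis
    reduces it to products of scalar functions. Iterating it handles forms in several moving
    arguments. *)
Lemma is_derive_lin_form (V : normedModType R) (U : set V) (B : V -> 'rV[R]_n -> R)
    (dB : 'rV[R]_n -> R) (p : V -> 'rV[R]_n) dp (z v : V) :
  open U -> U z -> (forall y, U y -> lin_form (B y)) ->
  (forall u, is_derive z v (B ^~ u) (dB u)) -> is_derive z v p dp ->
  is_derive z v (fun y => B y (p y)) (dB (p z) + B z dp).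
Proof.
move=> oU Uz lB dBu dpz.
have N : \near z, \sum_i (p z 0 i * B z (delta_mx 0 i)) = B z (p z).
  by apply: (near_open oU Uz) => y Uy; rewrite [RHS](lin_form_basis _ (lB y Uy)).
have ldB : lin_form dB.
  move=> a u w; have [_ <-] := dBu (a *: u + w).
  have N2 : \near z, (a *: B ^~ u + B ^~ w) z = B z (a *: u + w).
    by apply: (near_open oU Uz) => y Uy; rewrite (lB y Uy).
  by have [_ <-] := near_eq_is_derive N2 (is_deriveD (is_deriveZ a (dBu u)) (dBu w)).
have dpi i : is_derive z v (fun y => p y 0 i) (dp 0 i).
  exact: (is_derive_bcoo (bW := findim_rV R n) i dpz).
apply: (near_eq_is_derive N).
rewrite (lin_form_basis (p z) ldB) (lin_form_basis dp (lB z Uz)) -big_split /=.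
rewrite (_ : (fun y => _) = \sum_i ((fun y => p y 0 i) * (B ^~ (delta_mx 0 i)))); last first.
  by apply/funext => y; rewrite fct_sumE.
apply: is_derive_eq (is_derive_sum (fun i => is_deriveM (dpi i) (dBu (delta_mx 0 i)))) _.
by apply: eq_bigr => i _; rewrite [_ *: dp 0 i]mulrC.
Qed.

End Linear.

Section HorVer.
Variables (R : realType) (n : nat).
Local Notation RnRn := ('rV[R]_n * 'rV[R]_n)%type.

Definition hor (x : 'rV[R]_n) : RnRn := (x, 0).
Definition ver (x : 'rV[R]_n) : RnRn := (0, x).

Lemma horP a u v : hor (a *: u + v) = a *: hor u + hor v.
Proof. by rewrite /hor; congr (_, _); rewrite /= ?scaler0 ?addr0. Qed.

Lemma verP a u v : ver (a *: u + v) = a *: ver u + ver v.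
Proof. by rewrite /ver; congr (_, _); rewrite /= ?scaler0 ?addr0. Qed.

End HorVer.

(* The fundamental tensor of [l] and its derivatives along the base and along the fibre; [gy]
   is twice the Cartan tensor.  They are locked because failing unifications would
   otherwise unfold directional derivatives. *)
HB.lock Definition gm (R : realType) (n : nat)
    (l : 'rV[R]_n * 'rV[R]_n -> R) (z : 'rV[R]_n * 'rV[R]_n) (u w : 'rV[R]_n) : R :=
  2^-1 * 'D_(ver u) ('D_(ver w) l) z.

HB.lock Definition gx (R : realType) (n : nat)
    (l : 'rV[R]_n * 'rV[R]_n -> R) (z : 'rV[R]_n * 'rV[R]_n) (u w x : 'rV[R]_n) : R :=
  'D_(hor x) (fun z => gm l z u w) z.

HB.lock Definition gy (R : realType) (n : nat)
    (l : 'rV[R]_n * 'rV[R]_n -> R) (z : 'rV[R]_n * 'rV[R]_n) (u w x : 'rV[R]_n) : R :=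
  'D_(ver x) (fun z => gm l z u w) z.

Section LocalFinsler.
Variables (R : realType) (n : nat).
Local Notation RnRn := ('rV[R]_n * 'rV[R]_n)%type.
Variables (Om : set RnRn) (l : RnRn -> R).
Hypothesis oOm : open Om.
Hypothesis l_smooth : smooth Om l.
Local Notation gm := (gm l).
Local Notation gx := (gx l).
Local Notation gy := (gy l).

Lemma class_C_gm k u w : class_C k Om (fun z => gm z u w).
Proof.
have C : class_C k Om ('D_(ver u) ('D_(ver w) l)).
  by apply: class_C_derive; apply: class_C_derive; exact: (l_smooth k.+2).
rewrite gm.unlock; apply: class_C_mul => //; exact: class_C_cst.
Qed.

Lemma class_C_gx k u w x : class_C k Om (fun z => gx z u w x).
Proof. by rewrite gx.unlock; apply: class_C_derive; exact: class_C_gm. Qed.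

Lemma derive_lin (f : RnRn -> R) z a u v : class_C 1 Om f -> Om z ->
  'D_(a *: u + v) f z = a * 'D_u f z + 'D_v f z.
Proof.
move=> Cf Oz; apply: eq_trans (deriveDdir _ _ oOm Cf Oz) _; congr (_ + _).
exact: (deriveZdir _ _ oOm Cf Oz).
Qed.

Lemma derive_swapR (f : RnRn -> R) u v z : class_C 2 Om f -> Om z ->
  'D_v ('D_u f) z = 'D_u ('D_v f) z.
Proof. exact: derive_swap. Qed.

Lemma gm_sym z u w : Om z -> gm z u w = gm z w u.
Proof.
move=> Oz; rewrite gm.unlock.
exact: congr1 (derive_swapR (ver w) (ver u) (l_smooth 2) Oz).
Qed.

Lemma gm_linl z w : Om z -> lin_form (gm z ^~ w).
Proof.
move=> Oz a u v; rewrite gm.unlock verP mulrCA -mulrDr; congr (_ * _).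
by apply: derive_lin => //; apply: class_C_derive; exact: (l_smooth 2).
Qed.

Lemma gm_linr z u : Om z -> lin_form (gm z u).
Proof. by move=> Oz a v w; rewrite !(gm_sym u) // gm_linl. Qed.

Lemma derive_gm_linl z d w : Om z -> lin_form (fun u => 'D_d (fun z => gm z u w) z).
Proof.
move=> Oz a u v.
have D x : derivable (fun z => gm z x w) z d by exact: class_C_derivable (class_C_gm 1 x w) Oz.
have N : \near z, (a *: (fun z => gm z u w) + (fun z => gm z v w)) z = gm z (a *: u + v) w.
  by apply: (near_open oOm Oz) => y Oy; rewrite gm_linl.
have [_ E] := near_eq_is_derive N
  (is_deriveD (is_deriveZ a (derivableP (D u))) (derivableP (D v))).
exact: E.
Qed.

Lemma derive_gm_sym z d u w : Om z ->
  'D_d (fun z => gm z u w) z = 'D_d (fun z => gm z w u) z.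
Proof.
move=> Oz; apply: near_eq_derive; apply: (near_open oOm Oz) => y Oy.
exact: gm_sym.
Qed.

Lemma gx_sym z u w x : Om z -> gx z u w x = gx z w u x.
Proof. by rewrite gx.unlock; exact: derive_gm_sym. Qed.

Lemma gy_sym z u w x : Om z -> gy z u w x = gy z w u x.
Proof. by rewrite gy.unlock; exact: derive_gm_sym. Qed.

Lemma gx_lin1 z w x : Om z -> lin_form (fun u => gx z u w x).
Proof. by rewrite gx.unlock; exact: derive_gm_linl. Qed.

Lemma gy_lin1 z w x : Om z -> lin_form (fun u => gy z u w x).
Proof. by rewrite gy.unlock; exact: derive_gm_linl. Qed.

Lemma gx_lin2 z u x : Om z -> lin_form (fun w => gx z u w x).
Proof. by move=> Oz a v w; rewrite !(gx_sym u) // gx_lin1. Qed.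

Lemma gy_lin2 z u x : Om z -> lin_form (fun w => gy z u w x).
Proof. by move=> Oz a v w; rewrite !(gy_sym u) // gy_lin1. Qed.

Lemma gx_lin3 z u w : Om z -> lin_form (gx z u w).
Proof.
move=> Oz a v x; rewrite gx.unlock horP; apply: derive_lin => //.
exact: class_C_gm.
Qed.

Lemma gy_lin3 z u w : Om z -> lin_form (gy z u w).
Proof.
move=> Oz a v x; rewrite gy.unlock verP; apply: derive_lin => //.
exact: class_C_gm.
Qed.

Lemma gyE z u w x : Om z ->
  gy z u w x = 2^-1 * 'D_(ver x) ('D_(ver u) ('D_(ver w) l)) z.
Proof.
move=> Oz; rewrite gy.unlock gm.unlock; apply: deriveMl.
have C : class_C 1 Om ('D_(ver u) ('D_(ver w) l)).
  by apply: class_C_derive; apply: class_C_derive; exact: (l_smooth 3).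
exact: class_C_derivable C Oz.
Qed.

(** Schwarz applied to ['D_(ver w) l]. Together with [gy_sym] this gives the total symmetry of the
    Cartan tensor. *)
Lemma gy_swap13 z u w x : Om z -> gy z u w x = gy z x w u.
Proof.
move=> Oz.
have C : class_C 2 Om ('D_(ver w) l) by apply: class_C_derive; exact: (l_smooth 3).
apply: eq_trans (gyE u w x Oz) _; apply: eq_trans _ (esym (gyE x w u Oz)).
exact: congr1 (derive_swapR (ver u) (ver x) C Oz).
Qed.

Lemma derive_gy_gx z u w x y : Om z ->
  'D_(ver y) (fun z => gx z u w x) z = 'D_(hor x) (fun z => gy z u w y) z.
Proof.
move=> Oz; rewrite gx.unlock gy.unlock.
exact: derive_swapR (class_C_gm 2 u w) Oz.
Qed.

Lemma is_derive_gm z u w x y : Om z ->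
  is_derive z (x, y) (fun z => gm z u w) (gx z u w x + gy z u w y).
Proof.
move=> Oz; have C := class_C_gm 1 u w.
apply: DeriveDef; first exact: class_C_derivable C Oz.
have -> : (x, y) = 1 *: hor x + ver y.
  by rewrite scale1r; congr (_, _); rewrite /= ?addr0 ?add0r.
rewrite gx.unlock gy.unlock; apply: eq_trans (derive_lin 1 _ _ C Oz) _.
by rewrite mul1r.
Qed.

End LocalFinsler.

(** * Consequences of homogeneity along the fibre *)

Section Homogeneous.
Variables (R : realType) (n : nat).
Local Notation RnRn := ('rV[R]_n * 'rV[R]_n)%type.
Variables (Om : set RnRn) (l : RnRn -> R).
Hypothesis oOm : open Om.
Hypothesis l_smooth : smooth Om l.

Definition scale_fiber (a : R) (z : RnRn) : RnRn := (z.1, a *: z.2).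

Hypothesis Om_conic : forall z a, 0 < a -> Om z -> Om (scale_fiber a z).
Hypothesis l_hom : forall z a, 0 < a -> Om z -> l (scale_fiber a z) = a ^+ 2 * l z.

(** A vertical derivative lowers the degree of homogeneity by one: the chain rule produces a factor
    [a] on the left, which cancels the one in [a * b]. The choice [b = a] takes degree two to degree
    one, and [b = 1] takes degree one to degree zero. *)
Lemma derive_ver_scale (f : RnRn -> R) (a b : R) (w : 'rV[R]_n) z :
  class_C 1 Om f -> 0 < a -> (forall z, Om z -> f (scale_fiber a z) = a * b * f z) ->
  Om z -> 'D_(ver w) f (scale_fiber a z) = b * 'D_(ver w) f z.
Proof.
move=> Cf a0 fh Oz.
have dm : is_derive z (ver w) (scale_fiber a) (a *: ver w).
  apply/is_derive_cvgP.
  have : (fun _ : R => a *: ver w) @ 0^' --> a *: ver w by exact: cvg_cst.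
  apply: cvg_trans; apply: near_eq_cvg; near=> h.
  have h0 : h != 0 by near: h; exact: nbhs_dnbhs_neq.
  rewrite /scale_fiber /ver; congr (_, _) => /=.
    by rewrite !scaler0 add0r subrr scaler0.
  by rewrite -scalerBr addrK !scalerA mulrAC mulVf // mul1r.
have [_ E1] : is_derive z (ver w) (f \o scale_fiber a)
    ('D_(a *: ver w) f (scale_fiber a z)).
  exact: (is_derive_comp oOm Cf (Om_conic a0 Oz) dm).
have N : \near z, (a * b) * f z = (f \o scale_fiber a) z.
  by apply: (near_open oOm Oz) => y Oy /=; rewrite fh.
have df := class_C_derivable (ver w) Cf Oz.
have [_ E2] := near_eq_is_derive N (is_deriveZ (a * b) (derivableP df)).
have E3 : 'D_(a *: ver w) f (scale_fiber a z) = a * 'D_(ver w) f (scale_fiber a z).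
  exact: (deriveZdir (ver w) a oOm Cf (Om_conic a0 Oz)).
apply: (mulfI (lt0r_neq0 a0)).
apply: eq_trans (esym E3) _; apply: eq_trans (esym E1) _; apply: eq_trans E2 _.
exact: esym (mulrA _ _ _).
Unshelve. all: by end_near. Qed.

Lemma gm_scale_fiber a u w z : 0 < a -> Om z -> gm l (scale_fiber a z) u w = gm l z u w.
Proof.
move=> a0 Oz; rewrite gm.unlock; apply: (congr1 (fun r => 2^-1 * r)).
have C1 : class_C 1 Om ('D_(ver w) l) by apply: class_C_derive; exact: (l_smooth 2).
have H (y : RnRn) : Om y -> 'D_(ver w) l (scale_fiber a y) = a * 1 * 'D_(ver w) l y.
  rewrite mulr1; apply: (derive_ver_scale w (l_smooth 1) a0).
  by move=> x Ox; rewrite l_hom.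
apply: eq_trans (derive_ver_scale u C1 a0 H Oz) _.
exact: mul1r.
Qed.

(** This is C_v(., ., v) = 0: being homogeneous of degree zero, [gm] is constant along the ray
    through [z]. *)
Lemma gy_fiber z u w : Om z -> gy l z u w z.2 = 0.
Proof.
move=> Oz; rewrite gy.unlock.
suff [_ E] : is_derive z (ver z.2) (fun z => gm l z u w) 0 by exact: E.
apply/is_derive_cvgP.
have : (fun _ : R => 0 : R) @ 0^' --> (0 : R) by exact: cvg_cst.
apply: cvg_trans; apply: near_eq_cvg; near=> h => /=.
(* This makes [h + 1] positive, as homogeneity requires. *)
have h1 : `|h| < 1 by near: h; exact: dnbhs0_lt.
have -> : h *: ver z.2 + z = scale_fiber (h + 1) z.
  by rewrite /scale_fiber; case: (z) => x y; congr (_, _);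
     rewrite /= ?scaler0 ?add0r // scalerDl scale1r.
rewrite gm_scale_fiber ?subrr ?scaler0 //.
by move: h1; rewrite ltr_norml => /andP[? _]; rewrite -ltrBlDr sub0r.
Unshelve. all: by end_near. Qed.

(* On the horizontal line through [z] in direction [k] the fiber coordinate is
   constant, so [gy _ w z.2 x] vanishes along it. *)
Lemma derive_gx_fiber z w k x : Om z ->
  'D_(ver x) (fun y => gx l y w z.2 k) z = 0.
Proof.
move=> Oz; apply: eq_trans (derive_gy_gx oOm l_smooth w z.2 k x Oz) _.
suff [_ E] : is_derive z (hor k) (fun y => gy l y w z.2 x) 0 by exact: E.
have gy0 (y : RnRn) : Om y -> y.2 = z.2 -> gy l y w z.2 x = 0.
  move=> Oy <-; rewrite (gy_sym oOm l_smooth) // (gy_swap13 oOm l_smooth) //.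
  by rewrite (gy_sym oOm l_smooth) // gy_fiber.
apply/is_derive_cvgP.
have : (fun _ : R => 0 : R) @ 0^' --> (0 : R) by exact: cvg_cst.
apply: cvg_trans; apply: near_eq_cvg.
have Oh : \forall h \near 0^', Om (h *: hor k + z).
  have : (fun h : R => h *: hor k + z) @ 0^' --> z.
    rewrite -[X in _ --> X]add0r -(scale0r (hor k)); apply: cvgD; last exact: cvg_cst.
    by apply: cvgZr_tmp; exact: nbhs_dnbhs.
  by apply; exact: open_nbhs_nbhs.
near=> h => /=.
rewrite !gy0 ?subrr ?scaler0 //; last by rewrite /= scaler0 add0r.
by near: h.
Unshelve. all: by end_near. Qed.

End Homogeneous.

(** * Smoothness of the inverse matrix *)

Section Determinant.
Variables (R : realType) (V : normedModType R) (U : set V).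
Hypothesis oU : open U.

Lemma class_C_det k m (A : V -> 'M[R]_m) :
  (forall i j, class_C k U (fun z => A z i j)) ->
  class_C k U (fun z => \det (A z)).
Proof.
move=> CA; apply: class_C_sum => // s; apply: class_C_mul => //.
  exact: class_C_cst.
by apply: class_C_prod.
Qed.

(** Cramer's formula expresses each entry of the inverse as a cofactor, polynomial in the entries,
    over the determinant. *)
Lemma class_C_invmx k m (A : V -> 'M[R]_m) i j :
  (forall i j, class_C k U (fun z => A z i j)) ->
  (forall z, U z -> A z \in unitmx) ->
  class_C k U (fun z => invmx (A z) i j).
Proof.
move=> CA uA.
have : class_C k U (fun z => (\det (A z))^-1 * cofactor (A z) j i).
  apply: class_C_mul => //.
    apply: class_C_inv => //; last exact: class_C_det.
    by move=> z /uA; rewrite unitmxE unitfE.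
  apply: class_C_mul => //; first exact: class_C_cst.
  apply: class_C_det => a b.
  rewrite (_ : (fun z => _) = (fun z => A z (lift j a) (lift i b))) //.
  by apply/funext => z; rewrite !mxE.
by apply: class_C_eq => // z Uz; rewrite /invmx uA // !mxE.
Qed.

End Determinant.

(** * Raising indices, and smoothness of the Chern coefficients *)

Section Chern.
Variables (R : realType) (n : nat) (M : manifold R n).
Local Notation RnRn := ('rV[R]_n * 'rV[R]_n)%type.
Variables (L : TM M -> R) (c : chart M).
Variables (Om : set RnRn) (l : RnRn -> R).
Hypothesis oOm : open Om.
Hypothesis l_smooth : smooth Om l.
Hypothesis Om_conic : forall z a, 0 < a -> Om z -> Om (scale_fiber a z).
Hypothesis l_hom : forall z a, 0 < a -> Om z -> l (scale_fiber a z) = a ^+ 2 * l z.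
Hypothesis l_nondeg : forall z u, Om z -> (forall w, gm l z u w = 0) -> u = 0.
Local Notation e i := (delta_mx 0 i : 'rV[R]_n).
(** The only link between [L] and the function [l] on the coordinate domain [Om]. In the application
    [l] is [L \o nat_param c] and [Om] is [nat_image c A]. *)
Hypothesis g_coefE : forall z i j, Om z -> g_coef L c i j z = gm l z (e i) (e j).

Local Notation gm := (gm l).
Local Notation gx := (gx l).
Local Notation gy := (gy l).

Definition g_mx z := \matrix_(a, b) g_coef L c a b z.

Lemma gm_mx z V s : Om z -> gm z (e s) V = (g_mx z *m V^T) s 0.
Proof.
move=> Oz; rewrite (lin_form_basis _ (gm_linr oOm l_smooth (e s) Oz)) mxE.
by apply: eq_bigr => i _; rewrite !mxE g_coefE // mulrC.
Qed.

Lemma g_mx_unit z : Om z -> g_mx z \in unitmx.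
Proof.
move=> Oz; rewrite -row_free_unit; apply: inj_row_free => v vG.
apply: (l_nondeg Oz) => w.
have gt : (g_mx z)^T = g_mx z.
  by apply/matrixP => i j; rewrite !mxE !g_coefE // (gm_sym oOm l_smooth).
rewrite (gm_sym oOm l_smooth) // (lin_form_basis _ (gm_linl oOm l_smooth v Oz)).
apply: big1 => i _; rewrite gm_mx // -[g_mx z]gt -trmx_mul vG.
by rewrite !mxE mulr0.
Qed.

(** Characterises a vector with raised index by its pairings with the basis. With [gm_inj], it
    removes the inverse matrix from all later identities. *)
Lemma gm_raise z (r : 'I_n -> R) s : Om z ->
  gm z (e s) (\row_i \sum_j g_inv L c i j z * r j) = r s.
Proof.
move=> Oz; rewrite gm_mx //.
rewrite (_ : (\row_i _)^T = invmx (g_mx z) *m \col_j r j).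
  by rewrite mulKVmx ?g_mx_unit // mxE.
apply/colP => i; rewrite !mxE; apply: eq_bigr => j _.
by rewrite [(\col_j0 _ _) _ _]mxE.
Qed.

Lemma gm_inj z u v : Om z -> (forall s, gm z s u = gm z s v) -> u = v.
Proof.
move=> Oz uv; apply/eqP; rewrite -subr_eq0; apply/eqP; apply: (l_nondeg Oz) => w.
rewrite (gm_sym oOm l_smooth) // (lin_formB _ _ (gm_linr oOm l_smooth w Oz)).
by rewrite uv subrr.
Qed.

Lemma class_C_g_coef k i j : class_C k Om (g_coef L c i j).
Proof.
apply: class_C_eq (class_C_gm oOm l_smooth k (e i) (e j)) => // z Oz.
by rewrite g_coefE.
Qed.

Lemma class_C_g_inv k i j : class_C k Om (g_inv L c i j).
Proof.
change (class_C k Om (fun z => invmx (g_mx z) i j)).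
apply: class_C_invmx => //; last exact: g_mx_unit.
move=> a b; apply: class_C_eq (class_C_g_coef k a b) => // z _.
by rewrite mxE.
Qed.

Lemma ddx_g_coef z i j k : Om z -> ddx k (g_coef L c i j) z = gx z (e i) (e j) (e k).
Proof.
move=> Oz; rewrite gx.unlock; apply: near_eq_derive.
by apply: (near_open oOm Oz) => y Oy; exact: g_coefE.
Qed.

Lemma ddy_g_coef z i j k : Om z -> ddy k (g_coef L c i j) z = gy z (e i) (e j) (e k).
Proof.
move=> Oz; rewrite gy.unlock; apply: near_eq_derive.
by apply: (near_open oOm Oz) => y Oy; exact: g_coefE.
Qed.

Lemma class_C_ddx k i f : class_C k.+1 Om f -> class_C k Om (ddx i f).
Proof. exact: class_C_derive. Qed.

Lemma class_C_ddy k i f : class_C k.+1 Om f -> class_C k Om (ddy i f).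
Proof. exact: class_C_derive. Qed.

Lemma class_C_fiber_coord k i : class_C k Om (fun z : RnRn => z.2 0 i).
Proof.
apply: (@class_C_bcoo _ _ _ (findim_rV R n) k Om snd i) => //.
by apply: class_C_linear => // z; exact: cvg_snd.
Qed.

Lemma class_C_opp k (f : RnRn -> R) : class_C k Om f -> class_C k Om (fun z => - f z).
Proof.
move=> Cf; rewrite (_ : (fun z => _) = (fun z => (-1) * f z)).
  by apply: class_C_mul => //; exact: class_C_cst.
by apply/funext => z; rewrite mulN1r.
Qed.

Lemma class_C_spray_coef k i : class_C k Om (spray_coef L c i).
Proof.
have Cy j := class_C_fiber_coord k j.
apply: class_C_mul => //; first exact: class_C_cst.
apply: class_C_sum => // s; apply: class_C_sum => // j; apply: class_C_sum => // m.
apply: class_C_mul => //; apply: class_C_mul => //.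
apply: class_C_mul => //; first exact: class_C_g_inv.
have Cx a b d := class_C_ddx a (class_C_g_coef k.+1 b d).
apply: class_C_add => //; first by apply: class_C_mul => //; exact: class_C_cst.
exact: class_C_opp.
Qed.

Lemma class_C_deltadx k i f : class_C k.+1 Om f -> class_C k Om (deltadx L c i f).
Proof.
move=> Cf; apply: class_C_add => //; first exact: class_C_ddx.
apply: class_C_opp; apply: class_C_sum => // m; apply: class_C_mul => //.
  by apply: class_C_ddy; exact: class_C_spray_coef.
exact: class_C_ddy.
Qed.

Lemma class_C_chern_coef k i j m : class_C k Om (chern_coef L c i j m).
Proof.
have Cg a b := class_C_g_coef k.+1 a b.
apply: class_C_mul => //; first exact: class_C_cst.
apply: class_C_sum => // s; apply: class_C_mul => //; first exact: class_C_g_inv.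
apply: class_C_add => //; last exact: class_C_deltadx.
apply: class_C_add => //; first exact: class_C_deltadx.
by apply: class_C_opp; exact: class_C_deltadx.
Qed.

End Chern.

(** * Spray, nonlinear connection and Chern symbols as solutions of linear systems in g *)

Section ChernIdentities.
Variables (R : realType) (n : nat) (M : manifold R n).
Local Notation RnRn := ('rV[R]_n * 'rV[R]_n)%type.
Variables (L : TM M -> R) (c : chart M).
Variables (Om : set RnRn) (l : RnRn -> R).
Hypothesis oOm : open Om.
Hypothesis l_smooth : smooth Om l.
Hypothesis Om_conic : forall z a, 0 < a -> Om z -> Om (scale_fiber a z).
Hypothesis l_hom : forall z a, 0 < a -> Om z -> l (scale_fiber a z) = a ^+ 2 * l z.
Hypothesis l_nondeg : forall z u, Om z -> (forall w, gm l z u w = 0) -> u = 0.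
Local Notation e i := (delta_mx 0 i : 'rV[R]_n).
Hypothesis g_coefE : forall z i j, Om z -> g_coef L c i j z = gm l z (e i) (e j).

Local Notation gm := (gm l).
Local Notation gx := (gx l).
Local Notation gy := (gy l).

Definition spray z : 'rV[R]_n := \row_i spray_coef L c i z.
Definition nonlinear z (w : 'rV[R]_n) : 'rV[R]_n :=
  \row_k \sum_i w 0 i * nonlinear_coef L c k i z.
Definition chern z (u w : 'rV[R]_n) : 'rV[R]_n :=
  \row_i \sum_j \sum_k u 0 j * (w 0 k * chern_coef L c i j k z).
(** The derivative of the metric along delta/delta x, with arbitrary vectors in place of indices;
    [deltadx_g_coef] relates it to the coefficients. *)
Definition gdelta z u w x := gx z u w x - gy z u w (nonlinear z x).

Let gmL z w (Oz : Om z) := gm_linl oOm l_smooth w Oz.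
Let gmR z u (Oz : Om z) := gm_linr oOm l_smooth u Oz.
Let gx1 z w x (Oz : Om z) := gx_lin1 oOm l_smooth w x Oz.
Let gx2 z u x (Oz : Om z) := gx_lin2 oOm l_smooth u x Oz.
Let gx3 z u w (Oz : Om z) := gx_lin3 oOm l_smooth u w Oz.
Let gy1 z w x (Oz : Om z) := gy_lin1 oOm l_smooth w x Oz.
Let gy2 z u x (Oz : Om z) := gy_lin2 oOm l_smooth u x Oz.
Let gy3 z u w (Oz : Om z) := gy_lin3 oOm l_smooth u w Oz.
Let gxS z u w x (Oz : Om z) := gx_sym oOm l_smooth u w x Oz.
Let gyS z u w x (Oz : Om z) := gy_sym oOm l_smooth u w x Oz.

Lemma gm_spray z s : Om z ->
  gm z s (spray z) = 4^-1 * (2 * gx z s z.2 z.2 - gx z z.2 z.2 s).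
Proof.
move=> Oz; move: s; apply: lin_form_eq => [|a u v|s]; first exact: gmL.
  by rewrite (gx1 _ _ Oz) (gx3 _ _ Oz); ring.
pose r s := 4^-1 * \sum_j \sum_k
  (2 * ddx k (g_coef L c s j) z - ddx s (g_coef L c j k) z) * z.2 0 j * z.2 0 k.
have -> : spray z = \row_i \sum_j g_inv L c i j z * r j.
  apply/rowP => i; rewrite !mxE /spray_coef big_distrr; apply: eq_bigr => t _ /=.
  rewrite /r [RHS]mulrCA; congr (_ * _); rewrite big_distrr; apply: eq_bigr => j _ /=.
  by rewrite big_distrr; apply: eq_bigr => k _ /=; rewrite !mulrA.
rewrite (gm_raise oOm l_smooth l_nondeg g_coefE r s Oz) /r; congr (_ * _).
rewrite (lin_form_basis _ (gx2 (e s) z.2 Oz)) (lin_form_basis _ (gx1 z.2 (e s) Oz)).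
rewrite big_distrr -sumrB; apply: eq_bigr => j _ /=.
rewrite (lin_form_basis _ (gx3 (e s) (e j) Oz)) (lin_form_basis _ (gx2 (e j) (e s) Oz)).
rewrite !big_distrr -sumrB; apply: eq_bigr => k _ /=.
by rewrite !(ddx_g_coef oOm g_coefE) //; ring.
Qed.

Lemma is_derive_spray z w : Om z -> is_derive z (ver w) spray (nonlinear z w).
Proof.
move=> Oz; apply: (@is_derive_vec _ _ _ (findim_rV R n)) => k /=.
have C : class_C 1 Om (spray_coef L c k).
  exact: (class_C_spray_coef oOm l_smooth l_nondeg g_coefE).
rewrite (_ : (fun z => _) = spray_coef L c k); last by apply/funext => y; rewrite mxE.
apply: DeriveDef; first exact: class_C_derivable C Oz.
have ll : lin_form (fun w => 'D_(ver w) (spray_coef L c k) z).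
  by move=> a u v; rewrite /= verP; exact: (derive_lin oOm a (ver u) (ver v) C Oz).
by apply: eq_trans (lin_form_basis w ll) _; rewrite mxE.
Qed.

Lemma is_derive_gm_ver z u w x : Om z ->
  is_derive z (ver x) (fun z => gm z u w) (gy z u w x).
Proof.
move=> Oz; rewrite gy.unlock; apply: derivableP.
exact: class_C_derivable (class_C_gm oOm l_smooth 1 u w) Oz.
Qed.

Lemma is_derive_gx_ver z u w k x : Om z ->
  is_derive z (ver x) (fun z => gx z u w k) ('D_(ver x) (fun z => gx z u w k) z).
Proof.
move=> Oz; apply: derivableP.
exact: class_C_derivable (class_C_gx oOm l_smooth 1 u w k) Oz.
Qed.

Lemma is_derive_snd z x : is_derive z (ver x) (snd : RnRn -> 'rV[R]_n) x.
Proof. exact: (derive_linear z (ver x) (l := snd : RnRn -> 'rV[R]_n)). Qed.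

(** The vertical derivative of [gm_spray] along [w]. On the left both the metric and the spray vary.
    On the right only the explicit occurrences of y contribute: the derivative of [gx] itself
    disappears by [derive_gx_fiber], since y occupies one of its metric slots. *)
Lemma gm_nonlinear z s w : Om z ->
  gm z s (nonlinear z w) + gy z s (spray z) w =
  2^-1 * (gx z s z.2 w + gx z s w z.2 - gx z w z.2 s).
Proof.
move=> Oz.
have D1 := is_derive_lin_form oOm Oz (fun y Oy => gmR s Oy)
  (fun u => is_derive_gm_ver s u w Oz) (is_derive_spray w Oz).
have D2 : is_derive z (ver w) (fun y => gx y s y.2 y.2) (gx z s z.2 w + gx z s w z.2).
  have D u := is_derive_lin_form oOm Oz (fun y Oy => gx3 s u Oy)
    (fun k => is_derive_gx_ver s u k w Oz) (is_derive_snd z w).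
  have := is_derive_lin_form oOm Oz (fun y Oy => gx2 s y.2 Oy) D (is_derive_snd z w).
  move/is_derive_eq; apply.
  by rewrite (derive_gx_fiber oOm l_smooth Om_conic l_hom) // add0r.
have D3 : is_derive z (ver w) (fun y => gx y y.2 y.2 s) (gx z z.2 w s + gx z w z.2 s).
  have D u := is_derive_lin_form oOm Oz (fun y Oy => gx2 u s Oy)
    (fun k => is_derive_gx_ver u k s w Oz) (is_derive_snd z w).
  have := is_derive_lin_form oOm Oz (fun y Oy => gx1 y.2 s Oy) D (is_derive_snd z w).
  move/is_derive_eq; apply.
  by rewrite (derive_gx_fiber oOm l_smooth Om_conic l_hom) // add0r.
have N : \near z, (4^-1 * (2 * gx z s z.2 z.2 - gx z z.2 z.2 s)) = gm z s (spray z).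
  by apply: (near_open oOm Oz) => y Oy; rewrite gm_spray.
have [_ E1] := D1.
have [_ E2] := near_eq_is_derive N (is_deriveZ 4^-1 (is_deriveB (is_deriveZ 2 D2) D3)).
rewrite addrC; apply: eq_trans (esym E1) _; apply: eq_trans E2 _.
rewrite /GRing.scale /= (gxS z.2 w s Oz). lra.
Qed.

Lemma gm_injR z u v : Om z -> (forall s, gm z s u = gm z s v) -> u = v.
Proof. by move=> Oz; exact: (gm_inj oOm l_smooth l_nondeg Oz). Qed.

Lemma gy_swap23 z u w x : Om z -> gy z u w x = gy z u x w.
Proof. by move=> Oz; rewrite gyS // (gy_swap13 oOm l_smooth) // gyS. Qed.

Lemma gy_fiber3 z u w : Om z -> gy z u w z.2 = 0.
Proof. exact: (gy_fiber oOm l_smooth Om_conic l_hom). Qed.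

Lemma gy_fiber2 z u w : Om z -> gy z u z.2 w = 0.
Proof. by move=> Oz; rewrite gy_swap23 // gy_fiber3. Qed.

Lemma gy_fiber1 z u w : Om z -> gy z z.2 u w = 0.
Proof. by move=> Oz; rewrite gyS // gy_fiber2. Qed.

(** Euler's relation N(y) = 2 G. It is read off [gm_nonlinear] at w = y, where the Cartan term
    vanishes, instead of from a homogeneity property of the spray. *)
Lemma nonlinear_fiber z : Om z -> nonlinear z z.2 = 2 *: spray z.
Proof.
move=> Oz; apply: (gm_injR Oz) => s.
have := gm_nonlinear s z.2 Oz; rewrite gy_fiber3 // addr0 => ->.
by rewrite (lin_formZ _ _ (gmR s Oz)) gm_spray //; lra.
Qed.

Lemma nonlinear_delta z k m : nonlinear z (e k) 0 m = nonlinear_coef L c m k z.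
Proof.
rewrite mxE (bigD1 k) //= mxE !eqxx mul1r big1 ?addr0 // => i ik.
by rewrite mxE (negPf ik) andbF mul0r.
Qed.

Lemma nonlinearP z a u v : nonlinear z (a *: u + v) = a *: nonlinear z u + nonlinear z v.
Proof.
apply/rowP => k; rewrite !mxE big_distrr -big_split; apply: eq_bigr => i _ /=.
by rewrite !mxE; ring.
Qed.

Lemma chernP2 z u a v w : chern z u (a *: v + w) = a *: chern z u v + chern z u w.
Proof.
apply/rowP => i; rewrite !mxE big_distrr -big_split; apply: eq_bigr => j _ /=.
rewrite big_distrr -big_split; apply: eq_bigr => k _ /=.
by rewrite !mxE; ring.
Qed.

Lemma chernP1 z w a u v : chern z (a *: u + v) w = a *: chern z u w + chern z v w.
Proof.
apply/rowP => i; rewrite !mxE big_distrr -big_split; apply: eq_bigr => j _ /=.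
rewrite big_distrr -big_split; apply: eq_bigr => k _ /=.
by rewrite !mxE; ring.
Qed.

Lemma chern_delta z j k i : chern z (e j) (e k) 0 i = chern_coef L c i j k z.
Proof.
rewrite mxE (bigD1 j) //= [X in _ + X]big1 ?addr0; last first.
  by move=> m mj; apply: big1 => p _; rewrite mxE (negPf mj) andbF mul0r.
rewrite (bigD1 k) //= [X in _ + X]big1 ?addr0; last first.
  by move=> m mk; rewrite [e k _ _]mxE (negPf mk) andbF mul0r mulr0.
by rewrite !mxE !eqxx !mul1r.
Qed.

Lemma gdelta_sym z u w x : Om z -> gdelta z u w x = gdelta z w u x.
Proof. by move=> Oz; rewrite /gdelta gxS // gyS. Qed.

Lemma gdelta_lin1 z w x : Om z -> lin_form (fun u => gdelta z u w x).
Proof. by move=> Oz a u v; rewrite /gdelta (gx1 _ _ Oz) (gy1 _ _ Oz); ring. Qed.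

Lemma gdelta_lin2 z u x : Om z -> lin_form (fun w => gdelta z u w x).
Proof. by move=> Oz a v w; rewrite /gdelta (gx2 _ _ Oz) (gy2 _ _ Oz); ring. Qed.

Lemma gdelta_lin3 z u w : Om z -> lin_form (gdelta z u w).
Proof.
by move=> Oz a v x; rewrite /gdelta nonlinearP (gx3 _ _ Oz) (gy3 _ _ Oz); ring.
Qed.

Lemma deltadx_g_coef z i j k : Om z ->
  deltadx L c k (g_coef L c i j) z = gdelta z (e i) (e j) (e k).
Proof.
move=> Oz; rewrite /deltadx (ddx_g_coef oOm g_coefE) // /gdelta; congr (_ - _).
rewrite (lin_form_basis _ (gy3 (e i) (e j) Oz)); apply: eq_bigr => m _.
by rewrite nonlinear_delta (ddy_g_coef oOm g_coefE).
Qed.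

(** All three arguments enter linearly, so it suffices to test basis vectors, where [gm_raise]
    undoes the inverse matrix in [chern_coef]. *)
Lemma gm_chern z s u w : Om z -> gm z s (chern z u w) =
  2^-1 * (gdelta z s u w - gdelta z u w s + gdelta z w s u).
Proof.
move=> Oz.
have d1 := gdelta_lin1 _ _ Oz; have d2 := gdelta_lin2 _ _ Oz; have d3 := gdelta_lin3 _ _ Oz.
move: s; apply: lin_form_eq => [|a p q|s]; first exact: gmL.
  by rewrite (d1 u w) (d2 w u) (d3 u w); ring.
move: u; apply: lin_form_eq => [a p q|a p q|j].
- by rewrite chernP1 (gmR (e s) Oz).
- by rewrite (d1 w (e s)) (d2 (e s) w) (d3 w (e s)); ring.
move: w; apply: lin_form_eq => [a p q|a p q|k].
- by rewrite chernP2 (gmR (e s) Oz).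
- by rewrite (d1 (e s) (e j)) (d2 (e j) (e s)) (d3 (e s) (e j)); ring.
rewrite -!deltadx_g_coef //.
pose r s := 2^-1 * (deltadx L c k (g_coef L c s j) z - deltadx L c s (g_coef L c j k) z
     + deltadx L c j (g_coef L c k s) z).
rewrite -/(r s) -(gm_raise oOm l_smooth l_nondeg g_coefE r s Oz); congr (gm _ _ _).
apply/rowP => i; rewrite chern_delta !mxE /chern_coef big_distrr.
by apply: eq_bigr => t _; rewrite /r mulrCA.
Qed.

Lemma chern_sym z u w : Om z -> chern z u w = chern z w u.
Proof.
move=> Oz; apply: (gm_injR Oz) => s; rewrite !gm_chern //.
by rewrite (gdelta_sym w u) // (gdelta_sym s u) // (gdelta_sym w s) //; ring.
Qed.

(** In [gm_chern] at w = y, two of the vertical corrections have y in a slot of the Cartan tensor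
    and vanish. The third contains N(y) = 2 G and is, after the factor 1/2, the Cartan term of
    [gm_nonlinear]. *)
Lemma chern_fiber z u : Om z -> chern z u z.2 = nonlinear z u.
Proof.
move=> Oz; apply: (gm_injR Oz) => s; rewrite gm_chern // /gdelta.
have := gm_nonlinear s u Oz; rewrite nonlinear_fiber //.
rewrite gy_fiber2 // gy_fiber1 // (lin_formZ _ _ (gy3 s u Oz)).
by rewrite (gy_swap23 s (spray z) u Oz) (gxS z.2 s u Oz); lra.
Qed.

(** By [gm_chern] the first two terms on the right add up to [gdelta z u w x]; the third restores
    the vertical correction, because Gamma(x, y) = N(x). *)
Lemma chern_metric z u w x : Om z ->
  gx z u w x = gm z (chern z x u) w + gm z u (chern z x w) + gy z u w (chern z x z.2).
Proof.
move=> Oz; rewrite chern_fiber // (gm_sym oOm l_smooth) // !gm_chern //.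
rewrite (gdelta_sym w x) // (gdelta_sym u x) // (gdelta_sym w u) // /gdelta.
lra.
Qed.

End ChernIdentities.

(** * Charts and tangent vectors *)

(* [mathcomp.algebra.vector] exports another [coord]. *)
Local Notation coord := Defs.coord.

Section Charts.
Variables (R : realType) (n : nat) (M : manifold R n).
Implicit Types (c d : chart M) (p : M).

Lemma open_cod_preimage c (P : set M) : open P -> open (cod c `&` psi c @^-1` P).
Proof.
move=> oP; rewrite openE => x [cx Px]; apply: filterI.
  exact: open_nbhs_nbhs (conj (open_cod (c := c)) cx).
exact: psi_cont cx _ (open_nbhs_nbhs (conj oP Px)).
Qed.

Definition overlap c d := cod c `&` psi c @^-1` dom d.
Definition trans c d := phi d \o psi c.

Lemma open_overlap c d : open (overlap c d).
Proof. by apply: open_cod_preimage; exact: open_dom. Qed.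

Lemma overlap_phi c d p : dom c p -> dom d p -> overlap c d (phi c p).
Proof. by move=> cp dp; split; [exact: phi_cod | rewrite /= phiK]. Qed.

Lemma class_C_trans k c d : class_C k (overlap c d) (trans c d).
Proof. exact: transition_smooth. Qed.
Arguments class_C_trans k c d : clear implicits.
Arguments open_overlap c d : clear implicits.

Lemma trans_phi c d p : dom c p -> trans c d (phi c p) = phi d p.
Proof. by move=> cp; rewrite /trans /= phiK. Qed.

Lemma derive_transP c d p a u v : dom c p -> dom d p ->
  'D_(a *: u + v) (trans c d) (phi c p) =
  a *: 'D_u (trans c d) (phi c p) + 'D_v (trans c d) (phi c p).
Proof.
move=> cp dp; have O := overlap_phi cp dp; have C := class_C_trans 1 c d.
have oO := open_overlap c d.
have -> : 'D_(a *: u + v) (trans c d) (phi c p) =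
   'D_(a *: u) (trans c d) (phi c p) + 'D_v (trans c d) (phi c p).
  exact: (deriveDdir _ _ oO C O).
congr (_ + _); exact: (deriveZdir _ _ oO C O).
Qed.

Lemma derive_trans_comp c d e p y : dom c p -> dom d p -> dom e p ->
  is_derive (phi c p) y (trans c e)
    ('D_('D_y (trans c d) (phi c p)) (trans d e) (phi d p)).
Proof.
move=> cp dp ep.
have Ocd := overlap_phi cp dp; have Ode := overlap_phi dp ep.
have D1 : is_derive (phi c p) y (trans c d) ('D_y (trans c d) (phi c p)).
  by apply: derivableP; exact: class_C_derivable (class_C_trans 1 c d) Ocd.
have N : \forall x \near phi c p, (trans d e \o trans c d) x = trans c e x.
  apply: (near_open (open_overlap c d) Ocd) => x [cx dx].
  by rewrite /trans /= phiK.
apply: (near_eq_is_derive N); rewrite -(trans_phi d cp).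
rewrite -(trans_phi d cp) in Ode.
exact: (is_derive_comp (open_overlap d e) (class_C_trans 1 d e) Ode D1).
Qed.

Lemma derive_trans_id c p y : dom c p -> is_derive (phi c p) y (trans c c) y.
Proof.
move=> cp; apply: (near_eq_is_derive _ (is_derive_id (phi c p) y)).
apply: (near_open (open_cod (c := c)) (phi_cod cp)) => x cx.
by rewrite /trans /= psiK.
Qed.

Lemma coord_of_coord c d p y : dom c p -> dom d p ->
  coord d p (of_coord c p y) = 'D_y (trans c d) (phi c p).
Proof.
move=> cp dp; have [_ E] := derive_trans_comp y cp (chart_atP p) dp.
exact: esym E.
Qed.

Lemma of_coordK c p y : dom c p -> coord c p (of_coord c p y) = y.
Proof.
move=> cp; rewrite coord_of_coord //.
by have [_ E] := derive_trans_id y cp; exact: E.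
Qed.

Lemma coordK c p (v : tangent p) : dom c p -> of_coord c p (coord c p v) = v.
Proof.
move=> cp; have [_ E1] := derive_trans_id v (chart_atP p).
have [_ E2] := derive_trans_comp v (chart_atP p) cp (chart_atP p).
exact: eq_trans (esym E2) E1.
Qed.

Lemma coord_trans c d p (v : tangent p) : dom c p -> dom d p ->
  coord d p v = 'D_(coord c p v) (trans c d) (phi c p).
Proof.
move=> cp dp; apply: eq_trans (coord_of_coord (coord c p v) cp dp).
by rewrite coordK.
Qed.

Lemma coord_chart_at p (v : tangent p) : coord (chart_at p) p v = v.
Proof. by have [_ E] := derive_trans_id v (chart_atP p); exact: E. Qed.

Lemma coordP c p a (u v : tangent p) : dom c p ->
  coord c p (a *: u + v) = a *: coord c p u + coord c p v.
Proof. by move=> cp; exact: derive_transP (chart_atP p) cp. Qed.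

Lemma of_coordP c p a u v : dom c p ->
  of_coord c p (a *: u + v) = a *: of_coord c p u + of_coord c p v.
Proof. by move=> cp; exact: derive_transP cp (chart_atP p). Qed.

Lemma coord_zero c p : dom c p -> coord c p 0 = 0.
Proof. by move=> cp; have := coordP (-1) 0 0 cp; rewrite scaler0 addr0 scaleN1r addNr. Qed.

Lemma coordD c p (u v : tangent p) : dom c p ->
  coord c p (u + v) = coord c p u + coord c p v.
Proof. by move=> cp; have := coordP 1 u v cp; rewrite !scale1r. Qed.

Lemma coordZ c p a (u : tangent p) : dom c p -> coord c p (a *: u) = a *: coord c p u.
Proof. by move=> cp; have := coordP a u 0 cp; rewrite !addr0 coord_zero // addr0. Qed.

Lemma of_coord0 c p : dom c p -> of_coord c p 0 = 0.
Proof. by move=> cp; have := coordK (0 : tangent p) cp; rewrite coord_zero. Qed.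

Lemma of_coordZ c p a u : dom c p -> of_coord c p (a *: u) = a *: of_coord c p u.
Proof. by move=> cp; have := of_coordP a u 0 cp; rewrite !addr0 of_coord0 // addr0. Qed.

Lemma of_coordD c p u v : dom c p ->
  of_coord c p (u + v) = of_coord c p u + of_coord c p v.
Proof. by move=> cp; have := of_coordP 1 u v cp; rewrite !scale1r. Qed.

Lemma of_coordB c p u v : dom c p ->
  of_coord c p (u - v) = of_coord c p u - of_coord c p v.
Proof. by move=> cp; rewrite -scaleN1r of_coordD // of_coordZ // scaleN1r. Qed.

Lemma of_coord_sum c p (I : Type) (s : seq I) (u : I -> 'rV[R]_n) : dom c p ->
  of_coord c p (\sum_(i <- s) u i) = \sum_(i <- s) of_coord c p (u i).
Proof.
move=> cp; elim: s => [|i s IH]; first by rewrite !big_nil of_coord0.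
by rewrite !big_cons of_coordD // IH.
Qed.

Lemma nat_paramK c z : cod c z.1 -> nat_coord c (nat_param c z) = z.
Proof.
case: z => x y /= cx; rewrite /nat_coord /= psiK // of_coordK //.
exact: psi_dom.
Qed.

Lemma nat_coordK c v : dom c (foot v) -> nat_param c (nat_coord c v) = v.
Proof.
case: v => p v /= cp; rewrite /nat_param /= phiK // coordK //.
Qed.

Lemma nat_paramE c p v : dom c p -> nat_param c (phi c p, coord c p v) = tvec p v.
Proof. by move=> cp; exact: (nat_coordK (v := tvec p v)). Qed.

Lemma componentsE c p (X : vfield M) : dom c p -> components c X (phi c p) = coord c p (X p).
Proof. by move=> cp; rewrite /components phiK. Qed.

(** Regularity is asked on a neighbourhood [U] only: in nabla g the function is q -> g_V(Y, Z),
    which is controlled only where V takes values in [A]. *)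
Lemma dirderE c p (v : tangent p) (f : M -> R) (U : set 'rV[R]_n) :
  dom c p -> open U -> U (phi c p) -> class_C 1 U (f \o psi c) ->
  dirder p v f = 'D_(coord c p v) (f \o psi c) (phi c p).
Proof.
move=> cp oU Up Cf; rewrite /dirder; set d := chart_at p.
have dp : dom d p := chart_atP p.
have Odc := overlap_phi dp cp.
have D1 : is_derive (phi d p) v (trans d c) (coord c p v).
  by apply: derivableP; exact: class_C_derivable (class_C_trans 1 d c) Odc.
have N : \forall x \near phi d p, ((f \o psi c) \o trans d c) x = (f \o psi d) x.
  apply: (near_open (open_overlap d c) Odc) => x [dx cx].
  by rewrite /trans /= phiK.
rewrite -(trans_phi c dp) in Up *.
have [_ E] := near_eq_is_derive N (is_derive_comp oU Cf Up D1).
exact: E.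
Qed.

Lemma components_trans c d (X : vfield M) x : overlap d c x ->
  components d X x = 'D_(components c X (trans d c x)) (trans c d) (trans d c x).
Proof.
move=> [dx cx]; have dpx := psi_dom dx.
apply: eq_trans (coord_trans _ cx dpx) _.
change (trans d c x) with (phi c (psi d x)).
by rewrite (componentsE X cx).
Qed.

Lemma is_derive_dir_field (U : set 'rV[R]_n) (f Y : 'rV[R]_n -> 'rV[R]_n) x w :
  open U -> U x -> class_C 2 U f -> class_C 1 U Y ->
  is_derive x w (fun x => 'D_(Y x) f x) ('D_w ('D_(Y x) f) x + 'D_('D_w Y x) f x).
Proof.
move=> oU Ux Cf CY; apply: (@is_derive_vec _ _ _ (findim_rV R n)) => i.
rewrite bcooD.
pose B y u := 'D_u f y 0 i : R; pose dB u := 'D_w ('D_u f) x 0 i : R.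
have lB y : U y -> lin_form (B y).
  move=> Uy a u v; rewrite /B.
  have -> : 'D_(a *: u + v) f y = a *: 'D_u f y + 'D_v f y.
    have C1 := class_CW Cf.
    have -> : 'D_(a *: u + v) f y = 'D_(a *: u) f y + 'D_v f y.
      exact: (deriveDdir _ _ oU C1 Uy).
    congr (_ + _); exact: (deriveZdir _ _ oU C1 Uy).
  by rewrite !mxE.
have dBu u : is_derive x w (B ^~ u) (dB u).
  apply: (@is_derive_bcoo _ _ _ (findim_rV R n)); apply: derivableP.
  exact: class_C_derivable (class_C_derive u Cf) Ux.
have dY : is_derive x w Y ('D_w Y x).
  by apply: derivableP; exact: class_C_derivable CY Ux.
exact: is_derive_lin_form oU Ux lB dBu dY.
Qed.

(** The first summand, a second derivative of the transition map, is the defect of tensoriality. It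
    is symmetric in [u] and [v] by Schwarz, so it cancels in [bracketE]. *)
Lemma derive_components_trans c p (X Y : vfield M) : dom c p ->
  smooth_vfield Y -> let x := phi c p in
  let u := coord c p (X p) in let v := coord c p (Y p) in
  'D_(X p) (components (chart_at p) Y) (phi (chart_at p) p) =
  'D_u ('D_v (trans c (chart_at p))) x +
  'D_('D_u (components c Y) x) (trans c (chart_at p)) x.
Proof.
move=> cp sY x u v; set d := chart_at p.
have dp : dom d p := chart_atP p.
have Ocd := overlap_phi cp dp; have Odc := overlap_phi dp cp.
pose G y := 'D_(components c Y y) (trans c d) y.
have CY k : class_C k (overlap c d) (components c Y).
  by apply: class_C_sub (sY c k) => y [].
have CG : class_C 1 (overlap c d) G.
  apply: (class_C_derive_comp (open_overlap c d) (open_overlap c d) _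
    (class_C_trans 1 c d) _ (CY 1%N)); first by [].
  by move=> i; apply: class_C_derive; exact: class_C_trans.
have D1 : is_derive (phi d p) (X p) (trans d c) u.
  apply: derivableP.
  exact: class_C_derivable (class_C_trans 1 d c) Odc.
have N : \forall y \near phi d p, (G \o trans d c) y = components d Y y.
  apply: (near_open (open_overlap d c) Odc) => y Oy.
  exact: esym (components_trans Y Oy).
have Ox : overlap c d (trans d c (phi d p)) by rewrite trans_phi.
have [_ E1] := near_eq_is_derive N (is_derive_comp (open_overlap c d) CG Ox D1).
apply: eq_trans E1 _; rewrite trans_phi //.
have [_ E2] := is_derive_dir_field u (open_overlap c d) Ocd (class_C_trans 2 c d) (CY 1%N).
rewrite (componentsE Y cp) in E2; exact: E2.
Qed.

Lemma bracketE c p (X Y : vfield M) : dom c p -> smooth_vfield X -> smooth_vfield Y ->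
  bracket X Y p = of_coord c p
    ('D_(coord c p (X p)) (components c Y) (phi c p)
     - 'D_(coord c p (Y p)) (components c X) (phi c p)).
Proof.
move=> cp sX sY.
have E1 := derive_components_trans X cp sY; have E2 := derive_components_trans Y cp sX.
have dp := chart_atP p; have Ocd := overlap_phi cp dp.
have S : 'D_(coord c p (X p)) ('D_(coord c p (Y p)) (trans c (chart_at p))) (phi c p) =
    'D_(coord c p (Y p)) ('D_(coord c p (X p)) (trans c (chart_at p))) (phi c p).
  exact: (derive_swap _ _ (open_overlap c (chart_at p)) (class_C_trans 2 c (chart_at p)) Ocd).
have K (a a' b b' u v : 'rV[R]_n) : a = b + u -> a' = b' + v -> b = b' -> a - a' = u - v.
  by move=> -> -> ->; rewrite opprD addrACA subrr add0r.
apply: eq_trans (K _ _ _ _ _ _ E1 E2 S) _.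
exact: esym (of_coordB _ _ cp).
Qed.

End Charts.

Arguments class_C_trans {R n M} k c d.
Arguments open_overlap {R n M} c d.

(** * Extending local functions, fields and vectors to the whole manifold *)

Section Extension.
Variables (R : realType) (n : nat) (M : manifold R n).
Implicit Types (c d : chart M) (p : M).

(* The complement of [psi c @` K] is open because [M] is Hausdorff. *)
Lemma class_C_extend (W : normedModType R) {bW : findim W} c d
    (K : set 'rV[R]_n) (f : 'rV[R]_n -> W) k :
  compact K -> K `<=` cod c ->
  (forall x, cod d x -> ~ (psi c @` K) (psi d x) -> f x = 0) ->
  class_C k (overlap d c) f -> class_C k (cod d) f.
Proof.
move=> cK Kc f0 Cf; apply: class_C_local => x dx.
have [cx|ncx] := pselect (dom c (psi d x)); first by exists (overlap d c).
have clK : closed (psi c @` K).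
  apply: compact_closed; first exact: hausdorff.
  apply: continuous_compact => //; apply: continuous_in_subspaceT => y.
  by rewrite inE => /Kc; exact: psi_cont.
exists (cod d `&` psi d @^-1` (~` (psi c @` K))).
  by split=> // -[y Ky yx]; apply: ncx; rewrite -yx; exact: psi_dom (Kc _ Ky).
apply: (class_C_eq (f := fun=> 0)); last exact: class_C_cst.
  by apply: open_cod_preimage; exact: closed_openC.
by move=> y [dy nKy]; rewrite f0.
Qed.

(** Multiplication by [chi] turns data that are smooth only over the chart [c] into global smooth
    functions and fields with the same germ at [p]. In another chart, smoothness comes from the
    transition map on the overlap and from [class_C_extend] elsewhere. *)
Lemma bump_fields c p : dom c p ->
  exists chi : M -> R, [/\ (forall q, ~ dom c q -> chi q = 0),
    \forall q \near p, chi q = 1,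
    forall f : M -> R, smooth (cod c) (f \o psi c) -> smooth_fun (fun q => chi q * f q) &
    forall X : vfield M, smooth (cod c) (components c X) ->
      smooth_vfield (fun q => chi q *: X q)].
Proof.
move=> cp.
have [chi0 [K [Cchi0 chi01 cK Kc chi00]]] := bump_exists (open_cod (c := c)) (phi_cod cp).
(* The case distinction is essential: [phi c] has arbitrary values off [dom c]. *)
pose chi q := if `[< dom c q >] then chi0 (phi c q) else 0 : R.
have chiE q : dom c q -> chi q = chi0 (phi c q) by move=> cq; rewrite /chi asboolT.
have chiN q : ~ (psi c @` K) q -> chi q = 0.
  rewrite /chi => nKq; case: asboolP => // cq; apply: chi00 => Kq; apply: nKq.
  by exists (phi c q) => //; exact: phiK.
have oO d := open_overlap d c.
have tO d x : overlap d c x -> cod c (trans d c x) by move=> [_ cx]; exact: phi_cod.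
have Cchi k d : class_C k (overlap d c) (chi \o psi d).
  apply: (class_C_eq (oO d) (f := chi0 \o trans d c)).
    by move=> x [_ cx] /=; rewrite chiE.
  apply: (class_C_comp (U := setT) openT (oO d)) => //.
  exact: class_C_trans.
have sf (f : M -> R) : smooth (cod c) (f \o psi c) -> smooth_fun (fun q => chi q * f q).
  move=> sf d k; apply: (class_C_extend cK Kc).
    by move=> x _ nKx /=; rewrite chiN // mul0r.
  apply: (class_C_mul (f := chi \o psi d) (g := f \o psi d)) => //.
  apply: (class_C_eq (oO d) (f := (f \o psi c) \o trans d c)).
    by move=> x [_ cx] /=; rewrite /trans /= phiK.
  apply: (class_C_comp (open_cod (c := c)) (oO d) (tO d)); first exact: sf.
  exact: class_C_trans.
exists chi; split=> //.
- by move=> q ncq; rewrite /chi asboolF.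
- have N1 : \forall q \near p, dom c q by exact: open_nbhs_nbhs (conj (@open_dom R n M c) cp).
  have N2 : \forall q \near p, chi0 (phi c q) = 1 by exact: phi_cont cp _ chi01.
  by apply: filterS2 N1 N2 => q cq <-; rewrite chiE.
- move=> X sX d k; apply: (class_C_extend cK Kc).
    move=> x dx nKx; rewrite /components chiN // scale0r coord_zero //.
    exact: psi_dom.
  apply: (class_C_eq (oO d) (f := fun x => (chi \o psi d) x *:
      'D_(components c X (trans d c x)) (trans c d) (trans d c x))).
    move=> x Ox; have [dx cx] := Ox; have dpx := psi_dom dx.
    by rewrite -(components_trans X Ox) /components coordZ.
  apply: (class_C_scale (oO d) (Cchi k d)).
  have tOO x : overlap d c x -> overlap c d (trans d c x).
    by move=> [dx cx]; apply: overlap_phi => //; exact: psi_dom.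
  apply: (class_C_derive_comp (open_overlap c d) (oO d) tOO (class_C_trans 1 c d)).
    move=> i; apply: (class_C_comp (f := 'D_(bvec i) (trans c d))
      (open_overlap c d) (oO d) tOO).
      by apply: class_C_derive; exact: class_C_trans.
    exact: class_C_trans.
  apply: (class_C_comp (open_cod (c := c)) (oO d) (tO d)); first exact: sX.
  exact: class_C_trans.
Qed.

Lemma extend_vector c p (y : 'rV[R]_n) : dom c p ->
  exists X : vfield M, smooth_vfield X /\ \forall q \near p, X q = of_coord c q y.
Proof.
move=> cp; have [chi [_ chi1 _ /(_ (fun q => of_coord c q y)) sX]] := bump_fields cp.
exists (fun q => chi q *: of_coord c q y); split.
  apply: sX => k; apply: (class_C_eq (open_cod (c := c)) (f := fun=> y)).
    by move=> x cx; rewrite /components of_coordK //; exact: psi_dom.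
  exact: class_C_cst.
by apply: filterS chi1 => q ->; rewrite scale1r.
Qed.

Lemma extend_tangent p (v : tangent p) :
  exists2 X : vfield M, smooth_vfield X & X p = v.
Proof.
have [X [sX /nbhs_singleton Xp]] := extend_vector v (chart_atP p).
by exists X => //; rewrite Xp -[v in LHS]coord_chart_at coordK //; exact: chart_atP.
Qed.

End Extension.

(** * The Chern connection *)

Section FinslerChart.
Variables (R : realType) (n : nat) (M : manifold R n).
Variables (A : set (TM M)) (L : TM M -> R).
Hypothesis A_open : open_TM A.
Hypothesis A_conic : conic A.
Hypothesis L_Finsler : pseudo_Finsler A L.
Implicit Types (c d : chart M) (p : M) (v : TM M).

Local Notation l c := (L \o nat_param c).
Local Notation Om c := (nat_image c A).

Lemma nat_image_coord c v : A v -> dom c (foot v) -> Om c (nat_coord c v).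
Proof. by move=> Av cv; split; [exact: phi_cod | rewrite nat_coordK]. Qed.

Lemma derive1_line (V : normedModType R) (f : V -> R) (x e : V) :
  derive1 (fun s : R => f (x + s *: e)) 0 = 'D_e f x.
Proof. by rewrite derive1E derive_line scale0r addr0. Qed.

Lemma eq_derive1_0 (f g : R -> R) : f =1 g -> derive1 f 0 = derive1 g 0.
Proof. by move=> /funext ->. Qed.

Lemma fundamental_tensorE c p (v u w : tangent p) : dom c p ->
  fundamental_tensor L (tvec p v) u w =
  gm (l c) (phi c p, coord c p v) (coord c p u) (coord c p w).
Proof.
move=> cp; rewrite gm.unlock /fundamental_tensor.
apply: (congr1 (fun r => 2^-1 * r)); set z := (phi c p, coord c p v).
apply: eq_trans (derive1_line _ z (ver (coord c p u))); apply: eq_derive1_0 => t.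
apply: eq_trans (derive1_line _ (z + t *: ver (coord c p u)) (ver (coord c p w))).
apply: eq_derive1_0 => s /=.
rewrite -(nat_paramE _ cp) !(coordD _ _ cp) !(coordZ _ _ cp); congr (L (nat_param c _)).
by rewrite /ver /z; congr (_, _); rewrite /= !scaler0 !addr0.
Qed.

(** The factor 2 reconciles the 1/4 in the Cartan tensor with the 1/2 inside [gm]. Lines in the
    tangent space become vertical lines because [coord c p] is linear. *)
Lemma cartan_tensorE c p (v w1 w2 w3 : tangent p) : dom c p -> A (tvec p v) ->
  2 * cartan_tensor L (tvec p v) w1 w2 w3 =
  gy (l c) (phi c p, coord c p v) (coord c p w1) (coord c p w2) (coord c p w3).
Proof.
move=> cp Av; set z := (phi c p, coord c p v).
have Oz : Om c z := nat_image_coord Av cp.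
(* The Cartan tensor differentiates along [w1] innermost, whereas [gyE] has its second argument
   innermost; hence the exchange of the first two. *)
rewrite (gy_sym (@A_open c) (pF_smooth L_Finsler c)) //.
have E1 := gyE (pF_smooth L_Finsler c)
  (coord c p w2) (coord c p w1) (coord c p w3) Oz.
apply: eq_trans _ (esym E1).
set D := 'D_(ver (coord c p w3)) _ _.
suff E : cartan_tensor L (tvec p v) w1 w2 w3 = 4^-1 * D by rewrite E; clearbody D; lra.
rewrite /cartan_tensor; apply: (congr1 (fun r => 4^-1 * r)); rewrite /D.
apply: eq_trans (derive1_line _ z (ver (coord c p w3))); apply: eq_derive1_0 => s3.
apply: eq_trans (derive1_line _ _ (ver (coord c p w2))); apply: eq_derive1_0 => s2.
apply: eq_trans (derive1_line _ _ (ver (coord c p w1))); apply: eq_derive1_0 => s1 /=.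
rewrite -(nat_paramE _ cp) !(coordD _ _ cp) !(coordZ _ _ cp); congr (L (nat_param c _)).
rewrite /ver /z; congr (_, _); rewrite /= ?scaler0 ?addr0 //.
have K (x a b d : 'rV[R]_n) : x + (a + b + d) = x + d + b + a.
  by rewrite -!addrA [a + _]addrC -addrA addrCA.
exact: K.
Qed.

Lemma gm_eq (f : 'rV[R]_n * 'rV[R]_n -> R) z z' u u' w w' :
  z = z' -> u = u' -> w = w' -> gm f z u w = gm f z' u' w'.
Proof. by move=> -> -> ->. Qed.

Lemma Om_conic c z a : 0 < a -> Om c z -> Om c (scale_fiber a z).
Proof.
case: z => x y a0 [cx Axy]; split; first exact: cx.
have := A_conic Axy a0; rewrite /nat_param /= of_coordZ; first by apply.
exact: psi_dom.
Qed.

Lemma l_hom c z a : 0 < a -> Om c z -> l c (scale_fiber a z) = a ^+ 2 * l c z.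
Proof.
case: z => x y a0 [cx Axy] /=; apply: eq_trans _ (pF_homogeneous L_Finsler Axy a0).
by rewrite /nat_param /= of_coordZ; last exact: psi_dom.
Qed.

Lemma l_nondeg c z u : Om c z -> (forall w, gm (l c) z u w = 0) -> u = 0.
Proof.
case: z => x y [cx Axy] gu; have dx : dom c (psi c x) by exact: psi_dom.
have u0 : of_coord c (psi c x) u = 0.
  apply: (pF_nondegenerate L_Finsler Axy) => w.
  apply: eq_trans (fundamental_tensorE _ _ w dx) _.
  apply: eq_trans (gm_eq _ (nat_paramK (z := (x, y)) cx) (of_coordK u dx) erefl) _.
  exact: gu.
by rewrite -(of_coordK u dx) u0 (coord_zero dx).
Qed.

Lemma g_coefE c z i j : Om c z ->
  g_coef L c i j z = gm (l c) z (delta_mx 0 i) (delta_mx 0 j).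
Proof.
case: z => x y [cx Axy]; have dx : dom c (psi c x) by exact: psi_dom.
apply: eq_trans (fundamental_tensorE _ _ _ dx) _.
exact: gm_eq _ (nat_paramK (z := (x, y)) cx) (of_coordK _ dx) (of_coordK _ dx).
Qed.

(** The formula D_X Y + Gamma(X, Y) read in one chart. It is a total function, but it is meaningful
    only for vectors whose foot lies in [dom c]. *)
Definition chart_connection c : connection M := fun v X Y =>
  of_coord c (foot v)
    ('D_(coord c (foot v) (X (foot v))) (components c Y) (phi c (foot v)) +
     chern L c (nat_coord c v) (coord c (foot v) (X (foot v)))
       (coord c (foot v) (Y (foot v)))).

(** Conditions at a single vector: [chart_connection c] can satisfy them only over [dom c], and
    uniqueness is proved one vector at a time. *)
Definition torsion_free_at (v : TM M) (nabla : connection M) :=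
  forall X Y, smooth_vfield X -> smooth_vfield Y ->
    nabla v X Y - nabla v Y X = bracket X Y (foot v).

Definition metric_compatible_at (v : TM M) (nabla : connection M) :=
  forall X Y Z V, smooth_vfield X -> smooth_vfield Y -> smooth_vfield Z ->
    smooth_vfield V -> V (foot v) = vect v ->
    (\forall p \near foot v, A (tvec p (V p))) ->
    covariant_derivative_g L nabla v X Y Z V = 0.

Lemma chart_connection_torsion_free c v : A v -> dom c (foot v) ->
  torsion_free_at v (chart_connection c).
Proof.
move=> Av cv X Y sX sY; apply: eq_trans _ (esym (bracketE cv sX sY)).
apply: eq_trans (esym (of_coordB _ _ cv)) _.
apply: (congr1 (of_coord c (foot v))).
have K (a b u w : 'rV[R]_n) : u = w -> a + u - (b + w) = a - b.
  by move=> ->; rewrite opprD addrACA subrr addr0.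
apply: K; exact: (chern_sym (@A_open c) (pF_smooth L_Finsler c) (l_nondeg (c := c))
  (g_coefE (c := c)) _ _ (nat_image_coord Av cv)).
Qed.

End FinslerChart.

(** * Compatibility with the metric of the connection defined in a chart *)

Section MetricCompatibility.
Variables (R : realType) (n : nat) (M : manifold R n).
Variables (A : set (TM M)) (L : TM M -> R).
Hypothesis A_open : open_TM A.
Hypothesis A_conic : conic A.
Hypothesis L_Finsler : pseudo_Finsler A L.
Implicit Types (c d : chart M) (p : M) (v : TM M).

Local Notation l c := (L \o nat_param c).
Local Notation Om c := (nat_image c A).
Let oOm c : open (Om c) := @A_open c.
Let smO c : smooth (Om c) (l c) := pF_smooth L_Finsler c.

(** The coordinates of the points where V takes values in [A], which is where g_V(Y, Z) can be
    differentiated. *)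
Definition lifted_domain c (V : vfield M) :=
  [set x | cod c x /\ Om c (x, components c V x)].

Lemma open_lifted_domain c V : smooth_vfield V -> open (lifted_domain c V).
Proof.
move=> sV; rewrite openE => x [cx Ox]; apply: filterI.
  exact: open_nbhs_nbhs (conj (@open_cod R n M c) cx).
have cV : {for x, continuous (components c V)} := class_C_cont (sV c 0%N) cx.
have cxV : {for x, continuous (fun x => (x, components c V x))}.
  exact: (cvg_pair cvg_id cV).
exact: cxV (open_nbhs_nbhs (conj (@oOm c) Ox)).
Qed.

Lemma lifted_domain_phi c p (V : vfield M) : dom c p -> A (tvec p (V p)) ->
  lifted_domain c V (phi c p).
Proof.
move=> cp AV; split; first exact: phi_cod.
rewrite (componentsE V cp); exact: (nat_image_coord (v := tvec p (V p)) AV cp).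
Qed.

Lemma is_derive_lift c (V : vfield M) x u : smooth_vfield V -> cod c x ->
  is_derive x u (fun x => (x, components c V x)) (u, 'D_u (components c V) x).
Proof.
move=> sV cx; apply/is_derive_cvgP.
have /is_derive_cvgP D1 : is_derive x u (components c V) ('D_u (components c V) x).
  by apply: derivableP; exact: class_C_derivable (sV c 1%N) cx.
have /is_derive_cvgP D2 := is_derive_id x u.
have D := cvg_pair D2 D1.
exact: D.
Qed.

Lemma chart_metricE c (V Y Z : vfield M) x : cod c x ->
  fundamental_tensor L (tvec (psi c x) (V (psi c x))) (Y (psi c x)) (Z (psi c x)) =
  gm (l c) (x, components c V x) (components c Y x) (components c Z x).
Proof.
move=> cx; apply: eq_trans (fundamental_tensorE _ _ _ _ (psi_dom cx)) _.
by rewrite (psiK cx).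
Qed.

Lemma class_C_chart_metric c (V Y Z : vfield M) k :
  smooth_vfield V -> smooth_vfield Y -> smooth_vfield Z ->
  class_C k (lifted_domain c V) (fun x => gm (l c) (x, components c V x)
    (components c Y x) (components c Z x)).
Proof.
move=> sV sY sZ; set U := lifted_domain c V.
have oU : open U := open_lifted_domain sV.
have Uc : U `<=` cod c by move=> x [].
have C (X : vfield M) : smooth_vfield X -> class_C k U (components c X).
  by move=> sX; exact: class_C_sub Uc (sX c k).
have Ccoo (X : vfield M) i : smooth_vfield X -> class_C k U (fun x => components c X x 0 i).
  by move=> sX; exact: (@class_C_bcoo _ _ _ (findim_rV R n) _ _ _ i oU (C X sX)).
have : class_C k U (fun x => \sum_i components c Y x 0 i * \sum_j components c Z x 0 j *
    gm (l c) (x, components c V x) (delta_mx 0 i) (delta_mx 0 j)).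
  apply: class_C_sum => // i; apply: class_C_mul => //; first exact: Ccoo.
  apply: class_C_sum => // j; apply: class_C_mul => //; first exact: Ccoo.
  apply: (class_C_comp (f := fun z => gm (l c) z (delta_mx 0 i) (delta_mx 0 j))
    (g := fun x => (x, components c V x)) (@oOm c) oU).
  - by move=> x [].
  - exact: class_C_gm.
  apply: class_C_pair => //; last exact: C.
  by apply: class_C_linear => // x; exact: cvg_id.
apply: class_C_eq => // x [cx Ox].
rewrite (lin_form_basis _ (gm_linl (@oOm c) (@smO c) _ Ox)); apply: eq_bigr => i _.
by rewrite (lin_form_basis _ (gm_linr (@oOm c) (@smO c) _ Ox)).
Qed.

(** The four terms come from the base point, from the variation of V along the fibre, and from Y and
    Z. The second is the one that the Cartan term of nabla g must compensate. *)
Lemma is_derive_chart_metric c (V Y Z : vfield M) x u (z := (x, components c V x)) :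
  smooth_vfield V -> smooth_vfield Y -> smooth_vfield Z -> lifted_domain c V x ->
  is_derive x u (fun x => gm (l c) (x, components c V x)
    (components c Y x) (components c Z x))
   (gx (l c) z (components c Y x) (components c Z x) u
    + gy (l c) z (components c Y x) (components c Z x) ('D_u (components c V) x)
    + gm (l c) z ('D_u (components c Y) x) (components c Z x)
    + gm (l c) z (components c Y x) ('D_u (components c Z) x)).
Proof.
move=> sV sY sZ Ux; have [cx Oz] := Ux; have oU := open_lifted_domain (c := c) sV.
have dX (X : vfield M) : smooth_vfield X ->
    is_derive x u (components c X) ('D_u (components c X) x).
  by move=> sX; apply: derivableP; exact: class_C_derivable (sX c 1%N) cx.
have D0 a b : is_derive x u (fun x => gm (l c) (x, components c V x) a b)
    (gx (l c) z a b u + gy (l c) z a b ('D_u (components c V) x)).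
  have Cg := class_C_gm (@oOm c) (@smO c) 1 a b.
  have [_ E] := is_derive_gm (@oOm c) (@smO c) a b u ('D_u (components c V) x) Oz.
  rewrite -E.
  exact: (is_derive_comp (g := fun x => (x, components c V x)) (@oOm c) Cg Oz
    (is_derive_lift u sV cx)).
have D1 b := is_derive_lin_form oU Ux
  (fun y Uy => gm_linl (@oOm c) (@smO c) b Uy.2) (fun a => D0 a b) (dX Y sY).
exact: (is_derive_lin_form oU Ux
  (fun y Uy => gm_linr (@oOm c) (@smO c) (components c Y y) Uy.2) D1 (dX Z sZ)).
Qed.

Lemma chart_connection_metric c v : A v -> dom c (foot v) ->
  metric_compatible_at A L v (chart_connection L c).
Proof.
case: v => p v; rewrite /foot /= => Av cp X Y Z V sX sY sZ sV.
rewrite /foot /vect /= => Vp nA.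
have AVp : A (tvec p (V p)) by rewrite Vp.
have Up := lifted_domain_phi cp AVp.
rewrite /covariant_derivative_g /=.
set x := phi c p; set u := coord c p (X p).
have VE := componentsE V cp; have YE := componentsE Y cp; have ZE := componentsE Z cp.
pose z := (phi c p, coord c p v).
have zE : (phi c p, components c V (phi c p)) = z by rewrite VE Vp.
have Oz : Om c z by rewrite -zE; case: Up.
have D1 : dirder p (X p) (fun q => fundamental_tensor L (tvec q (V q)) (Y q) (Z q)) =
   gx (l c) z (coord c p (Y p)) (coord c p (Z p)) u
    + gy (l c) z (coord c p (Y p)) (coord c p (Z p)) ('D_u (components c V) x)
    + gm (l c) z ('D_u (components c Y) x) (coord c p (Z p))
    + gm (l c) z (coord c p (Y p)) ('D_u (components c Z) x).
  have oU := open_lifted_domain (c := c) sV.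
  have N y : lifted_domain c V y -> gm (l c) (y, components c V y)
      (components c Y y) (components c Z y) =
    ((fun q => fundamental_tensor L (tvec q (V q)) (Y q) (Z q)) \o psi c) y.
    by move=> [cy _]; exact: esym (chart_metricE V Y Z cy).
  have CF := class_C_eq oU N (class_C_chart_metric c 1%N sV sY sZ).
  apply: eq_trans (dirderE (X p) cp oU Up CF) _.
  have [_ E] := near_eq_is_derive (near_open oU Up N) (is_derive_chart_metric u sV sY sZ Up).
  by apply: eq_trans E _; rewrite zE YE ZE.
have ft1 (a b : tangent p) := fundamental_tensorE L v a b cp.
have ct := cartan_tensorE A_open L_Finsler (Y p) (Z p)
  (chart_connection L c (tvec p v) X V) cp Av.
have NE (W : vfield M) : coord c p (chart_connection L c (tvec p v) X W) =
  'D_u (components c W) x + chern L c z u (coord c p (W p)) := of_coordK _ cp.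
have F1 := eq_trans (ft1 _ (Z p)) (gm_eq (l c) (erefl z) (NE Y) erefl).
have F2 := eq_trans (ft1 (Y p) _) (gm_eq (l c) (erefl z) erefl (NE Z)).
have F3 := eq_trans ct (congr1 (gy (l c) z (coord c p (Y p)) (coord c p (Z p))) (NE V)).
have K (a b d e a' b' d' e' : R) : a = a' -> b = b' -> d = d' -> 2 * e = e' ->
    a' - b' - d' - e' = 0 -> a - b - d - 2 * e = 0.
  by move=> -> -> -> ->.
have gmL := gm_linl (@oOm c) (@smO c) _ Oz; have gmR := gm_linr (@oOm c) (@smO c) _ Oz.
have gy3 := gy_lin3 (@oOm c) (@smO c) _ _ Oz.
have CM := chern_metric (@oOm c) (@smO c) (@Om_conic _ _ _ A A_conic c)
  (@l_hom _ _ _ A L L_Finsler c) (@l_nondeg _ _ _ A L L_Finsler c)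
  (@g_coefE _ _ _ A L c) (coord c p (Y p)) (coord c p (Z p)) u Oz.
(* The derivatives of V, Y and Z cancel identically; what remains is [chern_metric], in which [m1],
   [m2] and [g] are the three terms on the right. *)
have K3 (a m1 m2 g gV gY gZ : R) : a = m1 + m2 + g ->
    a + gV + gY + gZ - (gY + m1) - (gZ + m2) - (gV + g) = 0 by move=> ->; ring.
have K2 (dY dZ dV : 'rV[R]_n) (y := coord c p (Y p)) (w := coord c p (Z p)) :
    gx (l c) z y w u + gy (l c) z y w dV + gm (l c) z dY w + gm (l c) z y dZ
    - gm (l c) z (dY + chern L c z u y) w - gm (l c) z y (dZ + chern L c z u w)
    - gy (l c) z y w (dV + chern L c z u z.2) = 0.
  rewrite (lin_formD _ _ (gmL _)) (lin_formD _ _ (gmR _)) (lin_formD _ _ (gy3 _ _)).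
  exact: K3 CM.
apply: (K _ _ _ _ _ _ _ _ D1 F1 F2 F3); rewrite Vp.
exact: K2.
Qed.

End MetricCompatibility.

(* Koszul's trick: the difference [T] of two solutions satisfies the homogeneous
   equations; these give successively [T V V = 0], [T X V = 0] and [T = 0]. *)
Lemma difference_tensor_eq0 (R : realType) (n : nat) (F : Type)
    (val : F -> 'rV[R]_n) (T : F -> F -> 'rV[R]_n) (V : F)
    (g : 'rV[R]_n -> 'rV[R]_n -> R) (h : 'rV[R]_n -> 'rV[R]_n -> 'rV[R]_n -> R) :
  (forall w, exists Z, val Z = w) ->
  (forall u w, g u w = g w u) ->
  (forall u, (forall w, g u w = 0) -> u = 0) ->
  (forall u w, h (val V) u w = 0) -> (forall u w, h u (val V) w = 0) ->
  (forall u w, h u w 0 = 0) ->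
  (forall X Y, T X Y = T Y X) ->
  (forall X Y Z, g (T X Y) (val Z) + g (val Y) (T X Z) + h (val Y) (val Z) (T X V) = 0) ->
  forall X Y, T X Y = 0.
Proof.
move=> sval gS g0 h1 h2 h3 TS E.
(* The sum of [E X Y Z] and [E Y X Z] minus [E Z X Y]; the symmetries of [g] and [T] leave a single
   metric term, doubled. *)
have K X Y Z : 2 * g (T X Y) (val Z) + h (val Y) (val Z) (T X V)
    + h (val X) (val Z) (T Y V) - h (val X) (val Y) (T Z V) = 0.
  have := E X Y Z; have := E Y X Z; have := E Z X Y.
  by rewrite (TS Y X) (TS Z X) (TS Z Y) (gS (val Y)); lra.
have TVV : T V V = 0.
  apply: g0 => w; have [Z <-] := sval w.
  by have := K V V Z; rewrite !h1; lra.
have TXV X : T X V = 0.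
  apply: g0 => w; have [Z <-] := sval w.
  by have := K X V Z; rewrite TVV h1 h2 h3; lra.
move=> X Y; apply: g0 => w; have [Z <-] := sval w.
by have := K X Y Z; rewrite !TXV !h3; lra.
Qed.

(** * Uniqueness at a given vector *)

Section Uniqueness.
Variables (R : realType) (n : nat) (M : manifold R n).
Variables (A : set (TM M)) (L : TM M -> R).
Hypothesis A_open : open_TM A.
Hypothesis A_conic : conic A.
Hypothesis L_Finsler : pseudo_Finsler A L.
Implicit Types (c d : chart M) (p : M) (v : TM M).

Local Notation l c := (L \o nat_param c).
Local Notation Om c := (nat_image c A).

(** Nabla g is evaluated with such a V. A field with constant components in a chart works, since the
    openness of [A] keeps it in [A] near the foot. *)
Lemma extend_in_A v : A v -> exists V : vfield M,
  [/\ smooth_vfield V, V (foot v) = vect v & \forall p \near foot v, A (tvec p (V p))].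
Proof.
case: v => p v Av; rewrite /foot /vect /=; set c := chart_at p.
have cp : dom c p := chart_atP p.
have [V [sV nV]] := extend_vector (coord c p v) cp.
have Vp : V p = v by rewrite (nbhs_singleton nV) coordK.
exists V; split => //.
have Oz : Om c (phi c p, coord c p v) := nat_image_coord (v := tvec p v) Av cp.
have N1 : \forall q \near p, dom c q by exact: open_nbhs_nbhs (conj (@open_dom R n M c) cp).
have cz : {for p, continuous (fun q => (phi c q, coord c p v))}.
  exact: (cvg_pair (phi_cont cp) (cvg_cst _)).
have N2 : \forall q \near p, Om c (phi c q, coord c p v).
  exact: cz (open_nbhs_nbhs (conj (@A_open c) Oz)).
apply: filterS3 N1 nV N2 => q cq -> [_ /=].
by rewrite /nat_param /= phiK.
Qed.

(** Both connections are tested with the same extension V, so the terms X(g_V(Y, Z)) and [X, Y] drop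
    out of the difference, which then falls under [difference_tensor_eq0]. *)
Lemma connection_unique_at v (nabla nabla' : connection M) : A v ->
  torsion_free_at v nabla -> metric_compatible_at A L v nabla ->
  torsion_free_at v nabla' -> metric_compatible_at A L v nabla' ->
  forall X Y, smooth_vfield X -> smooth_vfield Y -> nabla v X Y = nabla' v X Y.
Proof.
move=> Av tf mc tf' mc' X0 Y0 sX0 sY0.
have [V [sV Vv nV]] := extend_in_A Av.
move: v Av tf mc tf' mc' Vv nV => [p v] Av tf mc tf' mc'; rewrite /foot /vect /= => Vv nV.
set w := existT _ p v in tf mc tf' mc' *.
set c := chart_at p; have cp : dom c p := chart_atP p.
pose z := (phi c p, coord c p v).
have Oz : Om c z := nat_image_coord (v := tvec p v) Av cp.
(* The difference is regarded as a map on fields, not on vectors at [p]: only the values of fields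
   enter the metric terms, and tensoriality need not be established first. *)
pose F := {X : vfield M | smooth_vfield X}.
pose val (X : F) : 'rV[R]_n := coord c p (sval X p).
pose N (X Y : F) : 'rV[R]_n := coord c p (nabla w (sval X) (sval Y)).
pose N' (X Y : F) : 'rV[R]_n := coord c p (nabla' w (sval X) (sval Y)).
have oO := @A_open c; have sO := pF_smooth L_Finsler c.
have lO := @Om_conic _ _ _ A A_conic c; have hO := @l_hom _ _ _ A L L_Finsler c.
have gmL := gm_linl oO sO _ Oz; have gmR := gm_linr oO sO _ Oz.
have gy3 := gy_lin3 oO sO _ _ Oz.
have coordB (a b : tangent p) : coord c p (a - b) = coord c p a - coord c p b.
  by rewrite -scaleN1r coordD // coordZ // scaleN1r.
have T0 : forall X Y : F, N X Y - N' X Y = 0.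
  apply: (@difference_tensor_eq0 R n F val _ (exist _ V sV)
    (gm (l c) z) (gy (l c) z)).
  - move=> u; have [Z sZ Zp] := extend_tangent (of_coord c p u).
    by exists (exist _ Z sZ); rewrite /val /= Zp of_coordK.
  - by move=> a b; exact: (gm_sym oO sO a b Oz).
  - by move=> u; exact: (l_nondeg L_Finsler Oz).
  - by move=> a b; rewrite /val /= Vv; exact: (gy_fiber1 oO sO lO hO a b Oz).
  - by move=> a b; rewrite /val /= Vv; exact: (gy_fiber2 oO sO lO hO a b Oz).
  - by move=> a b; exact: (lin_form0 (gy3 a b)).
  - move=> [X sX] [Y sY].
    have K (a b a' b' k : 'rV[R]_n) : a - b = k -> a' - b' = k -> a - a' = b - b'.
      move=> <- E; rewrite -[a in LHS](subrK b) -E addrAC [a' - b' - a']addrAC.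
      by rewrite subrr sub0r addrC.
    have E := K _ _ _ _ _ (tf X Y sX sY) (tf' X Y sX sY).
    have E1 := coordB (nabla w X Y) (nabla' w X Y).
    have E2 := coordB (nabla w Y X) (nabla' w Y X).
    exact: (eq_trans (esym E1) (eq_trans (congr1 (coord c p) E) E2)).
  - move=> [X sX] [Y sY] [Z sZ].
    have E1 := mc X Y Z V sX sY sZ sV Vv nV.
    have E2 := mc' X Y Z V sX sY sZ sV Vv nV.
    (* Here [a] is the derivative X(g_V(Y, Z)), common to both connections. *)
    have K (a f1 f2 e f1' f2' e' m1 m2 m3 m1' m2' m3' t1 t2 t3 : R) :
        a - f1 - f2 - 2 * e = 0 -> a - f1' - f2' - 2 * e' = 0 ->
        f1 = m1 -> f2 = m2 -> 2 * e = m3 -> f1' = m1' -> f2' = m2' -> 2 * e' = m3' ->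
        t1 = m1 - m1' -> t2 = m2 - m2' -> t3 = m3 - m3' -> t1 + t2 + t3 = 0.
      clear; move=> H H' <- <- <- <- <- <- -> -> ->; lra.
    have ft (a b : tangent p) := fundamental_tensorE L v a b cp.
    have ct (a b d : tangent p) := cartan_tensorE A_open L_Finsler a b d cp Av.
    pose cn (W : vfield M) : 'rV[R]_n := coord c p (nabla w X W).
    pose cn' (W : vfield M) : 'rV[R]_n := coord c p (nabla' w X W).
    have B1 := lin_formB (cn Y) (cn' Y) (gmL (coord c p (Z p))).
    have B2 := lin_formB (cn Z) (cn' Z) (gmR (coord c p (Y p))).
    have B3 := lin_formB (cn V) (cn' V) (gy3 (coord c p (Y p)) (coord c p (Z p))).
    exact: (K _ _ _ _ _ _ _ _ _ _ _ _ _ _ _ _ E1 E2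
      (ft (nabla w X Y) (Z p)) (ft (Y p) (nabla w X Z)) (ct (Y p) (Z p) (nabla w X V))
      (ft (nabla' w X Y) (Z p)) (ft (Y p) (nabla' w X Z)) (ct (Y p) (Z p) (nabla' w X V))
      B1 B2 B3).
have E : coord c p (nabla w X0 Y0) = coord c p (nabla' w X0 Y0).
  exact: subr0_eq (T0 (exist _ X0 sX0) (exist _ Y0 sY0)).
exact: (eq_trans (esym (coordK (nabla w X0 Y0) cp))
  (eq_trans (congr1 (of_coord c p) E) (coordK (nabla' w X0 Y0) cp))).
Qed.

End Uniqueness.

(** * Vanishing of tensorial maps tested on coordinate fields *)

Section SmoothFields.
Variables (R : realType) (n : nat) (M : manifold R n).
Implicit Types (c d : chart M) (p : M) (X Y : vfield M) (f : M -> R).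

Lemma componentsD c X Y x : cod c x ->
  components c (fun p => X p + Y p) x = components c X x + components c Y x.
Proof. by move=> cx; exact: (coordD _ _ (psi_dom cx)). Qed.

Lemma componentsZ c f X x : cod c x ->
  components c (fun p => f p *: X p) x = f (psi c x) *: components c X x.
Proof. by move=> cx; exact: (coordZ _ _ (psi_dom cx)). Qed.

Lemma smooth_vfieldD X Y : smooth_vfield X -> smooth_vfield Y ->
  smooth_vfield (fun p => X p + Y p).
Proof.
move=> sX sY c k; have oc := @open_cod R n M c.
apply: (class_C_eq oc _ (class_C_add oc (sX c k) (sY c k))) => x cx.
exact: (esym (componentsD X Y cx)).
Qed.

Lemma smooth_vfieldZ f X : smooth_fun f -> smooth_vfield X ->
  smooth_vfield (fun p => f p *: X p).
Proof.
move=> sf sX c k; have oc := @open_cod R n M c.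
have C : class_C k (cod c) (fun x => (f \o psi c) x *: components c X x).
  exact: (class_C_scale oc (sf c k) (sX c k)).
apply: (class_C_eq oc _ C) => x cx.
exact: (esym (componentsZ f X cx)).
Qed.

Lemma smooth_fun_cst (a : R) : smooth_fun (fun _ : M => a).
Proof. by move=> c k; exact: (class_C_cst a). Qed.

(* chi^2 X = sum_j (chi X^j) (chi d/dx^j) holds globally for a bump function chi. *)
Lemma tensorial_eq0 c p (T : vfield M -> 'rV[R]_n) : dom c p ->
  (forall X Y, smooth_vfield X -> smooth_vfield Y -> T (fun p => X p + Y p) = T X + T Y) ->
  (forall f X, smooth_fun f -> smooth_vfield X -> T (fun p => f p *: X p) = f p *: T X) ->
  (forall j X, smooth_vfield X -> (\forall q \near p, X q = partial c j q) -> T X = 0) ->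
  forall X, smooth_vfield X -> T X = 0.
Proof.
move=> cp TD TZ Tp X sX; have oc := @open_cod R n M c.
have [chi [chi0 chi1 sf sv]] := bump_fields cp.
have chip : chi p = 1 := nbhs_singleton chi1.
have schi : smooth_fun chi.
  have := sf (fun=> 1) (fun k => class_C_cst (1 : R)).
  by rewrite (_ : (fun q => _) = chi) //; apply/funext => q; rewrite mulr1.
pose E j : vfield M := fun q => chi q *: partial c j q.
have sE j : smooth_vfield (E j).
  apply: sv => k; apply: (class_C_eq oc (f := fun=> delta_mx 0 j)); last exact: class_C_cst.
  by move=> x cx; exact: (esym (of_coordK _ (psi_dom cx))).
have TE j : T (E j) = 0.
  apply: (Tp j _ (sE j)); apply: filterS chi1 => q chiq; rewrite /E chiq.
  exact: scale1r.
pose a j (q : M) : R := chi q * coord c q (X q) 0 j.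
have sa j : smooth_fun (a j).
  apply: sf => k.
  exact: (@class_C_bcoo _ _ _ (findim_rV R n) k _ _ j oc (sX c k)).
pose S (s : seq 'I_n) : vfield M := fun q => \sum_(j <- s) a j q *: E j q.
have S0 s : smooth_vfield (S s) /\ T (S s) = 0.
  elim: s => [|j s [sS TS]].
    rewrite (_ : S [::] = fun q => (0 : R) *: X q); last first.
      by apply/functional_extensionality_dep => q; rewrite /S big_nil scale0r.
    split; first exact: smooth_vfieldZ (smooth_fun_cst 0) sX.
    by rewrite (TZ _ _ (smooth_fun_cst 0) sX) scale0r.
  have saE := smooth_vfieldZ (sa j) (sE j).
  rewrite (_ : S (j :: s) = fun q => a j q *: E j q + S s q); last first.
    by apply/functional_extensionality_dep => q; rewrite /S big_cons.
  split; first exact: smooth_vfieldD.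
  by rewrite (TD _ _ saE sS) TS addr0 (TZ _ _ (sa j) (sE j)) TE scaler0.
(* One factor [chi] makes the coefficients global functions, the other makes the coordinate fields
   global; off [dom c] both sides are zero. *)
have XS : (fun q => chi q *: (chi q *: X q)) = S (index_enum 'I_n).
  apply/functional_extensionality_dep => q; rewrite /S.
  have [cq|ncq] := pselect (dom c q); last first.
    rewrite chi0 // scale0r big1 // => j _.
    by rewrite /a chi0 // mul0r scale0r.
  rewrite -[X q in LHS](coordK _ cq) [coord c q (X q) in LHS]row_sum_delta.
  rewrite (of_coord_sum _ _ cq) !scaler_sumr; apply: eq_bigr => j _.
  rewrite (of_coordZ _ _ cq) /a /E /partial !scalerA; congr (_ *: _).
  by rewrite mulrAC.
have [_ TS] := S0 (index_enum 'I_n).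
have sX1 := smooth_vfieldZ schi sX.
move: TS; rewrite -XS (TZ _ _ schi sX1) (TZ _ _ schi sX) chip !scale1r.
exact.
Qed.

End SmoothFields.

(** * Gluing the chart connections, and their algebraic rules *)

Section ChernConnection.
Variables (R : realType) (n : nat) (M : manifold R n).
Variables (A : set (TM M)) (L : TM M -> R).
Hypothesis A_open : open_TM A.
Hypothesis A_conic : conic A.
Hypothesis L_Finsler : pseudo_Finsler A L.
Implicit Types (c d : chart M) (p : M) (v : TM M) (X Y Z : vfield M).

Local Notation Om c := (nat_image c A).
Local Notation nab c := (chart_connection L c).
Local Notation e i := (delta_mx 0 i : 'rV[R]_n).

Lemma chart_connection_eq c d v X Y : A v -> dom c (foot v) -> dom d (foot v) ->
  smooth_vfield X -> smooth_vfield Y -> nab c v X Y = nab d v X Y.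
Proof.
move=> Av cv dv sX sY.
exact: (connection_unique_at A_open A_conic L_Finsler Av
  (chart_connection_torsion_free A_open L_Finsler Av cv)
  (chart_connection_metric A_open A_conic L_Finsler Av cv)
  (chart_connection_torsion_free A_open L_Finsler Av dv)
  (chart_connection_metric A_open A_conic L_Finsler Av dv) sX sY).
Qed.

(** The chart depends on the foot through an arbitrary choice. This is harmless for the algebraic
    axioms, which concern one vector at a time; for smoothness [chern_nablaE] replaces it by a fixed
    chart. *)
Definition chern_nabla : connection M := fun v => nab (chart_at (foot v)) v.

Lemma chern_nablaE c v X Y : A v -> dom c (foot v) ->
  smooth_vfield X -> smooth_vfield Y -> chern_nabla v X Y = nab c v X Y.
Proof. by move=> Av cv; apply: chart_connection_eq => //; exact: chart_atP. Qed.

Lemma is_derive_components c X p u : smooth_vfield X -> dom c p ->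
  is_derive (phi c p) u (components c X) ('D_u (components c X) (phi c p)).
Proof.
move=> sX cp; apply: derivableP.
exact: (class_C_derivable u (sX c 1%N) (phi_cod cp)).
Qed.

Lemma near_cod c p : dom c p -> forall P : 'rV[R]_n -> Prop,
  (forall x, cod c x -> P x) -> \forall x \near phi c p, P x.
Proof. by move=> cp P; apply: near_open; [exact: open_cod | exact: phi_cod]. Qed.

Lemma chart_connection_addr c v X Y Z : dom c (foot v) ->
  smooth_vfield X -> smooth_vfield Y -> smooth_vfield Z ->
  nab c v X (fun p => Y p + Z p) = nab c v X Y + nab c v X Z.
Proof.
move=> cv sX sY sZ; rewrite /chart_connection.
set u := coord c _ (X _).
have [_ E] := near_eq_is_derive
  (near_cod cv (fun x cx => esym (componentsD Y Z cx)))
  (is_deriveD (is_derive_components u sY cv) (is_derive_components u sZ cv)).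
have E2 := chernP2 L c (nat_coord c v) u 1 (coord c (foot v) (Y (foot v)))
  (coord c (foot v) (Z (foot v))).
rewrite !scale1r in E2.
apply: eq_trans _ (of_coordD _ _ cv); apply: (congr1 (of_coord c (foot v))).
rewrite (coordD _ _ cv) E2.
have K (a b1 b2 m1 m2 : 'rV[R]_n) : a = b1 + b2 -> a + (m1 + m2) = b1 + m1 + (b2 + m2).
  by move=> ->; rewrite addrACA.
exact: (K _ _ _ _ _ E).
Qed.

Lemma chart_connection_addl c v X Y Z : dom c (foot v) ->
  smooth_vfield X -> smooth_vfield Y -> smooth_vfield Z ->
  nab c v (fun p => X p + Y p) Z = nab c v X Z + nab c v Y Z.
Proof.
move=> cv sX sY sZ; rewrite /chart_connection (coordD _ _ cv).
set u := coord c _ (X _); set w := coord c _ (Y _).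
have E : 'D_(u + w) (components c Z) (phi c (foot v)) =
    'D_u (components c Z) (phi c (foot v)) + 'D_w (components c Z) (phi c (foot v)).
  exact: (deriveDdir _ _ (@open_cod R n M c) (sZ c 1%N) (phi_cod cv)).
have E2 := chernP1 L c (nat_coord c v) (coord c (foot v) (Z (foot v))) 1 u w.
rewrite !scale1r in E2.
apply: eq_trans _ (of_coordD _ _ cv); apply: (congr1 (of_coord c (foot v))).
rewrite E2.
have K (a b1 b2 m1 m2 : 'rV[R]_n) : a = b1 + b2 -> a + (m1 + m2) = b1 + m1 + (b2 + m2).
  by move=> ->; rewrite addrACA.
exact: (K _ _ _ _ _ E).
Qed.

Lemma chart_connection_scalel c f v X Y : dom c (foot v) -> smooth_vfield Y ->
  nab c v (fun p => f p *: X p) Y = f (foot v) *: nab c v X Y.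
Proof.
move=> cv sY; rewrite /chart_connection (coordZ _ _ cv).
set u := coord c _ (X _); set a := f _.
have E : 'D_(a *: u) (components c Y) (phi c (foot v)) =
    a *: 'D_u (components c Y) (phi c (foot v)).
  exact: (deriveZdir _ _ (@open_cod R n M c) (sY c 1%N) (phi_cod cv)).
have E2 := chernP1 L c (nat_coord c v) (coord c (foot v) (Y (foot v))) a u 0.
have chern0 : chern L c (nat_coord c v) 0 (coord c (foot v) (Y (foot v))) = 0.
  have := chernP1 L c (nat_coord c v) (coord c (foot v) (Y (foot v))) (-1) 0 0.
  by rewrite scaler0 addr0 scaleN1r addNr.
rewrite addr0 chern0 addr0 in E2.
apply: eq_trans _ (of_coordZ _ _ cv); apply: (congr1 (of_coord c (foot v))).
have K (b b' m : 'rV[R]_n) : b = a *: b' -> b + a *: m = a *: (b' + m).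
  by move=> ->; rewrite scalerDr.
rewrite E2; exact: (K _ _ _ E).
Qed.

Lemma is_derive_scale (f : 'rV[R]_n -> R) (F : 'rV[R]_n -> 'rV[R]_n) x u df dF :
  is_derive x u f df -> is_derive x u F dF ->
  is_derive x u (fun y => f y *: F y) (df *: F x + f x *: dF).
Proof.
move=> Df DF; apply: (@is_derive_vec _ _ _ (findim_rV R n)) => i.
have Fi := is_derive_bcoo (bW := findim_rV R n) i DF.
rewrite (_ : (fun y => _) = f * (fun y => F y 0 i)); last first.
  by apply/funext => y /=; rewrite mxE.
apply: is_derive_eq (is_deriveM Df Fi) _.
by rewrite /= !mxE addrC; congr (_ + _); exact: mulrC.
Qed.

Lemma chart_connection_leibniz c f v X Y : dom c (foot v) -> smooth_fun f ->
  smooth_vfield Y ->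
  nab c v X (fun p => f p *: Y p) =
  dirder (foot v) (X (foot v)) f *: Y (foot v) + f (foot v) *: nab c v X Y.
Proof.
move=> cv sf sY; rewrite /chart_connection.
set u := coord c _ (X _); set y := coord c _ (Y _); set a := f _.
have DE : dirder (foot v) (X (foot v)) f = 'D_u (f \o psi c) (phi c (foot v)).
  exact: (dirderE _ cv (@open_cod R n M c) (phi_cod cv) (sf c 1%N)).
have Df : is_derive (phi c (foot v)) u (f \o psi c) ('D_u (f \o psi c) (phi c (foot v))).
  by apply: derivableP; exact: (class_C_derivable u (sf c 1%N) (phi_cod cv)).
have [_ E] := near_eq_is_derive
  (near_cod cv (fun x cx => esym (componentsZ f Y cx)))
  (is_derive_scale Df (is_derive_components u sY cv)).
have fE : (f \o psi c) (phi c (foot v)) = a by rewrite /= phiK.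
have E2 := chernP2 L c (nat_coord c v) u a y 0.
have chern0 : chern L c (nat_coord c v) u 0 = 0.
  have := chernP2 L c (nat_coord c v) u (-1) 0 0.
  by rewrite scaler0 addr0 scaleN1r addNr.
rewrite addr0 chern0 addr0 in E2.
rewrite (componentsE Y cv) fE -DE in E.
have YE : Y (foot v) = of_coord c (foot v) y := esym (coordK _ cv).
rewrite (coordZ _ _ cv) -/y E2.
have K (k : R) (dY b m : 'rV[R]_n) : b = k *: y + a *: dY ->
    of_coord c (foot v) (b + a *: m) =
    k *: of_coord c (foot v) y + a *: of_coord c (foot v) (dY + m).
  move=> ->; rewrite -addrA -scalerDr [LHS](of_coordD _ _ cv).
  by rewrite (of_coordZ k y cv) (of_coordZ a _ cv).
by rewrite [in RHS]YE; exact: (K _ _ _ _ E).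
Qed.

End ChernConnection.

(** * Existence of the Chern connection, and its determination by Christoffel symbols *)

Section ChernNabla.
Variables (R : realType) (n : nat) (M : manifold R n).
Variables (A : set (TM M)) (L : TM M -> R).
Hypothesis A_open : open_TM A.
Hypothesis A_conic : conic A.
Hypothesis L_Finsler : pseudo_Finsler A L.
Implicit Types (c d : chart M) (p : M) (v : TM M) (X Y Z : vfield M).

Local Notation Om c := (nat_image c A).
Local Notation RnRn := ('rV[R]_n * 'rV[R]_n)%type.

Lemma class_C_chern k c (U W : RnRn -> 'rV[R]_n) :
  class_C k (Om c) U -> class_C k (Om c) W ->
  class_C k (Om c) (fun z => chern L c z (U z) (W z)).
Proof.
move=> CU CW; have oO := @A_open c.
apply: (@class_C_vec _ _ _ (findim_rV R n)) => // i /=.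
have CUi j := @class_C_bcoo _ _ _ (findim_rV R n) k _ _ j oO CU.
have CWi j := @class_C_bcoo _ _ _ (findim_rV R n) k _ _ j oO CW.
rewrite (_ : (fun z => _) = (fun z => \sum_j \sum_m
    U z 0 j * (W z 0 m * chern_coef L c i j m z))); last first.
  by apply/funext => z; rewrite mxE.
apply: class_C_sum => // j; apply: class_C_sum => // m.
apply: class_C_mul => //; first exact: CUi.
apply: class_C_mul => //; first exact: CWi.
exact: (class_C_chern_coef oO (pF_smooth L_Finsler c)
  (@l_nondeg _ _ _ A L L_Finsler c) (@g_coefE _ _ _ A L c)).
Qed.

Lemma chern_nabla_smooth X Y : smooth_vfield X -> smooth_vfield Y ->
  forall c, smooth (Om c)
    (fun z => coord c (psi c z.1) (chern_nabla L (nat_param c z) X Y)).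
Proof.
move=> sX sY c k; have oO := @A_open c; have oc := @open_cod R n M c.
have Oc (z : RnRn) : Om c z -> cod c z.1 by case.
have Cfst : class_C k (Om c) (fst : RnRn -> 'rV[R]_n).
  by apply: class_C_linear => // z; exact: cvg_fst.
have Cc Z : smooth_vfield Z -> class_C k (Om c) (fun z => components c Z z.1).
  by move=> sZ; exact: (class_C_comp oc oO Oc (sZ c k) Cfst).
have CD : class_C k (Om c) (fun z => 'D_(components c X z.1) (components c Y) z.1).
  apply: (class_C_derive_comp oc oO Oc (sY c 1%N) _ (Cc X sX)) => i.
  apply: (class_C_comp (f := 'D_(bvec i) (components c Y)) oc oO Oc _ Cfst).
  by apply: class_C_derive; exact: sY.
have CC := class_C_add oO CD (class_C_chern (Cc X sX) (Cc Y sY)).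
apply: (class_C_eq oO _ CC) => z Oz; have cz := Oc z Oz.
have dz : dom c (foot (nat_param c z)) := psi_dom cz.
rewrite (chern_nablaE A_open A_conic L_Finsler (proj2 Oz) dz sX sY).
apply: eq_trans _ (esym (of_coordK _ dz)).
by rewrite (nat_paramK cz) /= (psiK cz).
Qed.

Lemma chern_nabla_christoffel c :
  has_christoffel A (chern_nabla L) c (fun i j k v => chern_coef L c i j k (nat_coord c v)).
Proof.
move=> v j k X Y Av cv sX sY nX nY.
rewrite (chern_nablaE A_open A_conic L_Finsler Av cv sX sY) /chart_connection.
have Xv : coord c (foot v) (X (foot v)) = delta_mx 0 j.
  by rewrite (nbhs_singleton nX); exact: of_coordK.
have Yv : coord c (foot v) (Y (foot v)) = delta_mx 0 k.
  by rewrite (nbhs_singleton nY); exact: of_coordK.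
(* The components of [Y] are constant near the foot, so the derivative term vanishes and only the
   Chern symbols remain. *)
have cYk : \forall x \near phi c (foot v), cst (delta_mx 0 k) x = components c Y x.
  have N : \forall x \near phi c (foot v), Y (psi c x) = partial c k (psi c x).
    have pc : {for phi c (foot v), continuous (psi c)} := psi_cont (phi_cod cv).
    rewrite /prop_for /continuous_at phiK // in pc.
    exact: pc nY.
  have N2 := near_cod cv (fun x cx => cx).
  apply: filterS2 N N2 => x E cx.
  by rewrite /components E; exact: (esym (of_coordK _ (psi_dom cx))).
have [_ D0] := near_eq_is_derive cYk
  (is_derive_cst (delta_mx 0 k : 'rV[R]_n) (phi c (foot v)) (coord c (foot v) (X (foot v)))).
rewrite [X in _ (X + _)]D0 add0r Xv Yv [chern _ _ _ _ _]row_sum_delta (of_coord_sum _ _ cv).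
apply: eq_bigr => i _; rewrite (of_coordZ _ _ cv) chern_delta.
by [].
Qed.

Lemma chern_connection_chern_nabla : chern_connection A L (chern_nabla L).
Proof.
split; last exact: chern_nabla_christoffel.
split.
- exact: chern_nabla_smooth.
- by move=> X Y Z v _; exact: (chart_connection_addr L (chart_atP (foot v))).
- by move=> X Y Z v _; exact: (chart_connection_addl L (chart_atP (foot v))).
- by move=> f X Y v _ _ _; exact: (chart_connection_scalel L f X (chart_atP (foot v))).
- move=> f X Y v _ sf _.
  exact: (chart_connection_leibniz L X (chart_atP (foot v)) sf).
Qed.

(** The derivation terms of the two Leibniz rules cancel, so the difference is linear over functions
    in both fields; [tensorial_eq0] is applied first in X, then in Y, which reduces it to coordinate
    fields. *)
Lemma has_christoffel_unique c (nabla nabla' : connection M) Gamma v X Y :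
  anisotropic_connection A nabla -> anisotropic_connection A nabla' ->
  has_christoffel A nabla c Gamma -> has_christoffel A nabla' c Gamma ->
  A v -> dom c (foot v) -> smooth_vfield X -> smooth_vfield Y ->
  nabla v X Y = nabla' v X Y.
Proof.
move=> an an' ch ch' Av cv sX sY.
have addrB (a b a' b' : 'rV[R]_n) : a + b - (a' + b') = (a - a') + (b - b').
  by rewrite opprD addrACA.
pose T (X Y : vfield M) : 'rV[R]_n := nabla v X Y - nabla' v X Y.
have TD1 X1 X2 Z : smooth_vfield X1 -> smooth_vfield X2 -> smooth_vfield Z ->
    T (fun p => X1 p + X2 p) Z = T X1 Z + T X2 Z.
  by move=> s1 s2 sZ; rewrite /T (ac_addl an Av) // (ac_addl an' Av) // addrB.
have TD2 X1 X2 Z : smooth_vfield X1 -> smooth_vfield X2 -> smooth_vfield Z ->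
    T Z (fun p => X1 p + X2 p) = T Z X1 + T Z X2.
  by move=> s1 s2 sZ; rewrite /T (ac_addr an Av) // (ac_addr an' Av) // addrB.
have TZ1 f X1 Z : smooth_fun f -> smooth_vfield X1 -> smooth_vfield Z ->
    T (fun p => f p *: X1 p) Z = f (foot v) *: T X1 Z.
  by move=> sf s1 sZ; rewrite /T (ac_scalel an Av) // (ac_scalel an' Av) // -scalerBr.
have TZ2 f X1 Z : smooth_fun f -> smooth_vfield X1 -> smooth_vfield Z ->
    T Z (fun p => f p *: X1 p) = f (foot v) *: T Z X1.
  move=> sf s1 sZ; rewrite /T (ac_leibniz an Av) // (ac_leibniz an' Av) //.
  by rewrite addrB subrr add0r -scalerBr.
apply/eqP; rewrite -subr_eq0; apply/eqP.
apply: (tensorial_eq0 (T := T ^~ Y) cv) => //.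
- by move=> X1 X2 s1 s2; exact: TD1.
- by move=> f X1 sf s1; exact: TZ1.
move=> j X1 s1 n1; apply: (tensorial_eq0 (T := T X1) cv) => //.
- by move=> Y1 Y2 t1 t2; exact: TD2.
- by move=> f Y1 sf t1; exact: TZ2.
move=> k Y1 t1 m1; rewrite /T (ch v j k) // (ch' v j k) // subrr.
by [].
Qed.

Lemma chern_connectionE nabla v X Y : chern_connection A L nabla -> A v ->
  smooth_vfield X -> smooth_vfield Y -> nabla v X Y = chern_nabla L v X Y.
Proof.
move=> [an ch] Av sX sY; have [an' ch'] := chern_connection_chern_nabla.
have cv := chart_atP (foot v).
exact: (has_christoffel_unique an an' (ch _) (ch' _) Av cv sX sY).
Qed.

End ChernNabla.

(** [chern_connection] is a predicate on connections, so existence is claimed separately; otherwise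
    the second part could hold vacuously. Connections are total functions, and the equality in the
    uniqueness claim is therefore agreement on [A] and on smooth fields. *)
Theorem mainTheorem5 (R : realType) (n : nat) (M : manifold R n)
    (A : set (TM M)) (L : TM M -> R)
    (A_open : open_TM A) (A_conic : conic A)
    (A_slit : forall v, A v -> vect v <> 0)
    (A_onto : (@foot R n M) @` A = [set: M])
    (L_Finsler : pseudo_Finsler A L) :
  (exists nabla : connection M, chern_connection A L nabla) /\
  (forall nabla : connection M, chern_connection A L nabla ->
    [/\ torsion_free A nabla,
        metric_compatible A L nabla &
        forall nabla' : connection M,
          anisotropic_connection A nabla' -> torsion_free A nabla' ->
          metric_compatible A L nabla' ->
          eq_connection A nabla' nabla]).
Proof.
split; first by exists (chern_nabla L); exact: chern_connection_chern_nabla.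
move=> nabla nablaC.
(* Any connection with the Chern symbols agrees with [chern_nabla], so torsion and nabla g can be
   computed at each vector in the chart of its foot. *)
have nablaE v X Y : A v -> smooth_vfield X -> smooth_vfield Y ->
    nabla v X Y = chern_nabla L v X Y.
  exact: (chern_connectionE A_open A_conic L_Finsler nablaC).
have tf : torsion_free A nabla.
  move=> v X Y Av sX sY; rewrite (nablaE v X Y Av sX sY) (nablaE v Y X Av sY sX).
  exact: (chart_connection_torsion_free A_open L_Finsler Av (chart_atP (foot v)) sX sY).
have mc : metric_compatible A L nabla.
  move=> v X Y Z V Av sX sY sZ sV Vv nV; rewrite /covariant_derivative_g.
  rewrite (nablaE v X Y Av sX sY) (nablaE v X Z Av sX sZ) (nablaE v X V Av sX sV).
  exact: (chart_connection_metric A_open A_conic L_Finsler Av (chart_atP (foot v))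
    sX sY sZ sV Vv nV).
split=> // nabla' _ tf' mc' v X Y Av sX sY.
apply: (connection_unique_at A_open A_conic L_Finsler Av _ _ _ _ sX sY).
- by move=> X1 Y1; exact: tf'.
- by move=> X1 Y1 Z1 V1; exact: mc'.
- by move=> X1 Y1; exact: tf.
- by move=> X1 Y1 Z1 V1; exact: mc.
Qed.
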